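(* Let $M$ be a Type I manifold of dimension at least $2$ with a foliation (of dimension $1$) in which there is at least one long leaf. Then there is a neighbourhood of the long leaf which intersects only long leaves.
   Context: Manifolds are connected Hausdorff, locally Euclidean spaces (not assumed metrisable or second countable), without boundary. A foliation (always of dimension $1$, topological) on an $n$-manifold $M$ is given by a maximal atlas of foliated charts $\varphi:U\to\mathbb R\times\mathbb R^{n-1}$ (homeomorphisms from open sets $U$ covering $M$ onto open boxes) whose coordinate changes are locally of the form $(x,y)\mapsto(f(x,y),g(y))$ with $y\in\mathbb R^{n-1}$. Plaques are the sets $\varphi^{-1}(\mathbb R\times\{y\})$; the leaf topology on $M$ is the topology generated by the open subsets of plaques, and leaves are the connected components of $M$ in the leaf topology, each a connected $1$-manifold. The homeomorphism type of a leaf refers to its leaf topology. The closed long ray $\mathbb L_{\ge0}$ is $\omega_1\times[0,1)$ with the lexicographic order topology; the long ray is $\mathbb L_+=\mathbb L_{\ge0}\setminus\{0\}$; the long line $\mathbb L$ is obtained by gluing two copies of $\mathbb L_{\ge 0}$ along their endpoint $0$. Every connected Hausdorff $1$-manifold is homeomorphic to exactly one of $\mathbb S^1,\mathbb R,\mathbb L_+,\mathbb L$; a leaf is short if it is homeomorphic to $\mathbb S^1$ or $\mathbb R$, and long if it is homeomorphic to $\mathbb L_+$ or $\mathbb L$. A space $X$ is of Type I if it is the union of an $\omega_1$-sequence $\langle U_\alpha : \alpha<\omega_1\rangle$ of open subspaces such that each $\overline{U_\alpha}$ is Lindelöf and $\overline{U_\alpha}\subset U_\beta$ whenever $\alpha<\beta<\omega_1$.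 *)

(* Defs.v *)
From HB Require Import structures.
From mathcomp Require Import all_boot all_order all_algebra.
From mathcomp Require Import all_classical wochoice all_reals.
From mathcomp Require Import topology normedtype wedge_sigT.
Set Implicit Arguments.
Unset Strict Implicit.
Unset Printing Implicit Defensive.
Import Order.TTheory GRing.Theory Num.Theory numFieldNormedType.Exports.
Local Open Scope classical_set_scope.
Local Open Scope ring_scope.

(* The ordinal omega_1 is realised as the set of elements of a fixed
   well-ordering of [set nat] which have only countably many predecessors.
   The lemmas [omega1_well_ordered], [omega1_countable_segment] and
   [omega1_uncountable] below characterise it up to order isomorphism. *)
Definition wo_rel : rel (set nat) := sval (well_ordering_principle (set nat)).

Definition omega1 : Type :=
  {x : set nat | `[< countable [set y | wo_rel y x] >]}.

HB.instance Definition _ := Choice.on omega1.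

Lemma wo_relP : well_order wo_rel.
Proof. exact: svalP (well_ordering_principle (set nat)). Qed.

Local Lemma wo_rel_chain : wo_chain wo_rel predT.
Proof. by move=> A _; exact: wo_relP. Qed.

Lemma wo_rel_total : total wo_rel.
Proof. by move=> x y; exact: (wo_chainW wo_rel_chain). Qed.

Lemma wo_rel_refl : reflexive wo_rel.
Proof. by move=> x; have := wo_rel_total x x; rewrite orbb. Qed.

Lemma wo_rel_anti : antisymmetric wo_rel.
Proof. by move=> x y; exact: (wo_chain_antisymmetric wo_rel_chain). Qed.

Lemma wo_rel_trans : transitive wo_rel.
Proof.
move=> y x z xy yz.
have [|m [[mA mmin] _]] := wo_relP (A := [pred t | t \in [:: x; y; z]]).
  by exists x; rewrite !inE eqxx.
have [mx my mz] : [/\ wo_rel m x, wo_rel m y & wo_rel m z].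
  by split; apply: mmin; rewrite !inE eqxx ?orbT.
move: mA; rewrite !inE => /or3P[]/eqP em; subst m => //.
- by have -> : x = y by apply: wo_rel_anti; rewrite xy mx.
- by have -> : z = y by apply: wo_rel_anti; rewrite my yz.
Qed.

Fact omega1_display : Order.disp_t. Proof. exact: Order.Disp tt tt. Qed.

Local Definition omega1_le : rel omega1 := fun a b => wo_rel (val a) (val b).

Local Lemma omega1_le_refl : reflexive omega1_le.
Proof. by move=> a; exact: wo_rel_refl. Qed.

Local Lemma omega1_le_anti : antisymmetric omega1_le.
Proof. by move=> a b /wo_rel_anti /val_inj. Qed.

Local Lemma omega1_le_trans : transitive omega1_le.
Proof. by move=> b a c; exact: wo_rel_trans. Qed.

HB.instance Definition _ := Order.Le_isPOrder.Build omega1_display omega1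
  omega1_le_refl omega1_le_anti omega1_le_trans.

Local Lemma omega1_le_total : total (<=%O : rel omega1).
Proof. by move=> a b; exact: wo_rel_total. Qed.

HB.instance Definition _ :=
  Order.POrder_isTotal.Build omega1_display omega1 omega1_le_total.

Local Lemma card_le_inj T U (A : set T) (B : set U) (f : T -> U) :
  set_fun A B f -> set_inj A f -> (A #<= B)%card.
Proof.
move=> fAB fI; have /injfunPex[g] : exists2 f, set_fun A B f & set_inj A f.
  by exists f.
exact (inj_card_le g).
Qed.

Lemma omega1_well_ordered (A : set omega1) :
  A !=set0 -> exists2 a, A a & forall b, A b -> (a <= b)%O.
Proof.
move=> [a0 Aa0].
pose P := [pred x : set nat | `[< exists2 a, A a & val a = x >]].
have [|m [[mP mmin] _]] := wo_relP (A := P).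
  by exists (val a0); apply/asboolP; exists a0.
move: mP => /asboolP[a Aa em]; exists a => // b Ab.
suff : wo_rel (val a) (val b) by [].
by rewrite em; apply: mmin; apply/asboolP; exists b.
Qed.

Lemma omega1_countable_segment (a : omega1) : countable [set b | (b <= a)%O].
Proof.
have /asboolP ca := svalP a.
apply: (sub_countable _ ca); apply: (@card_le_inj _ _ _ _ val) => //.
by move=> x y _ _ /val_inj.
Qed.

Lemma omega1_uncountable : ~ countable [set: omega1].
Proof.
move=> co.
pose bad := [pred x : set nat | `[< ~ countable [set y | wo_rel y x] >]].
have all_good x : countable [set y | wo_rel y x].
  apply: contrapT => bx.
  have [|m [[/asboolP mbad mmin] _]] := wo_relP (A := bad).
    by exists x; apply/asboolP.
  apply: mbad.
  apply: (@sub_countable _ _ _ ([set m] `|` [set val a | a in [set: omega1]])).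
    apply: subset_card_le => y /= ym.
    have [|ny] := pselect (countable [set z | wo_rel z y]).
      by move=> cy; right; exists (exist _ y (introT (asboolP _) cy)).
    left; apply: wo_rel_anti; rewrite ym mmin//.
    exact/asboolP.
  rewrite -bigcup2inE; apply: bigcup_countable => // -[|[|i]] _ //=.
  exact: sub_countable (card_image_le _ _) co.
have : countable [set: set nat].
  apply: sub_countable co.
  apply: (card_le_inj
    (f := fun x => exist _ x (introT (asboolP _) (all_good x)) : omega1)) => //.
  by move=> x y _ _ [].
case/countable_injP => f finj.
pose D := [set n | exists2 A, f A = n & ~ A n].
have [DfD|nDfD] := pselect (D (f D)).
  have [A /finj fA nA] := DfD; apply: nA.
  by rewrite fA ?inE.
by apply: (nDfD); exists D.
Qed.

Local Lemma ex_omega1_0 : exists a : omega1, forall b : omega1, (a <= b)%O.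
Proof.
have [|a _ amin] := @omega1_well_ordered setT; last by exists a => b; exact: amin.
apply: contrapT => /set0P/negP/negPn/eqP e0.
by apply: omega1_uncountable; rewrite e0.
Qed.

Definition omega1_0 : omega1 := projT1 (cid ex_omega1_0).

Lemma omega1_0P (a : omega1) : (omega1_0 <= a)%O.
Proof. exact: (projT2 (cid ex_omega1_0)). Qed.

Section LongSpaces.
Variable R : realType.

Definition Ico01 : Type := {x : R | (0 <= x) && (x < 1)}.

HB.instance Definition _ := SubChoice.on Ico01.
HB.instance Definition _ :=
  [SubChoice_isSubOrder of Ico01 by <: with Order.Disp tt tt].

Local Lemma Ico01_0_subproof : (0 <= 0 :> R) && (0 < 1 :> R).
Proof. by rewrite lexx ltr01. Qed.

Definition Ico01_0 : Ico01 := exist _ 0 Ico01_0_subproof.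

Definition closed_long_ray : orderTopologicalType _ :=
  order_topology (omega1 *l Ico01)%type.

Definition long_ray_origin : closed_long_ray := (omega1_0, Ico01_0).

Definition long_ray : set closed_long_ray := [set~ long_ray_origin].

Definition long_line : topologicalType :=
  wedge (fun _ : bool => long_ray_origin).

End LongSpaces.

Definition homeomorphism {S T : topologicalType} (A : set S) (B : set T)
    (f : S -> T) : Prop :=
  f @` A = B /\
  exists g : T -> S, [/\ {in A, cancel f g},
    {within A, continuous f} & {within B, continuous g}].

Definition homeomorphic {S T : topologicalType} (A : set S) (B : set T) : Prop :=
  exists f : S -> T, homeomorphism A B f.

Definition lindelof {T : topologicalType} (A : set T) : Prop :=
  forall C : set (set T), (forall O, C O -> open O) ->
    A `<=` \bigcup_(O in C) O ->
  exists C' : set (set T),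
    [/\ C' `<=` C, countable C' & A `<=` \bigcup_(O in C') O].

Definition type_I (X : topologicalType) : Prop :=
  exists U : omega1 -> set X,
    [/\ forall a, open (U a),
        forall a, lindelof (closure (U a)),
        forall a b, (a < b)%O -> closure (U a) `<=` U b
      & \bigcup_a U a = setT].

Definition manifold (R : realType) (n : nat) (M : topologicalType) : Prop :=
  [/\ connected [set: M],
      hausdorff_space M
    & forall x : M, exists2 U : set M, open U /\ U x
      & exists2 V : set 'rV[R]_n, open V & homeomorphic U V].

Section Foliations.
Variables (R : realType) (n : nat) (M : topologicalType).

(* The model space R x R^(n-1) of foliated charts on an n-manifold. *)
Local Notation model := (R * 'rV[R]_n.-1)%type.

(* Boxes may be unbounded, and may be empty; neither affects which foliations
   exist, as charts can be restricted and empty charts impose nothing. *)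
Definition open_box (B : set model) : Prop :=
  exists (I : interval R) (J : 'I_n.-1 -> interval R),
    [/\ itv_open_ends I, forall i, itv_open_ends (J i)
      & B = [set z : model | z.1 \in I /\ forall i, z.2 ord0 i \in J i]].

(* Only the restriction of [chart_map] to [chart_dom] is meaningful. *)
Record chart := Chart { chart_dom : set M; chart_map : M -> model }.

Definition foliated_chart (c : chart) : Prop :=
  open (chart_dom c) /\
  exists2 B : set model, open_box B
    & homeomorphism (chart_dom c) B (chart_map c).

(* Near each point of the common domain, the change of coordinates from [c]
   to [c'] has the form (x, y) |-> (f (x, y), g y). *)
Definition foliated_change (c c' : chart) : Prop :=
  forall p : M, chart_dom c p -> chart_dom c' p ->
  exists (f : model -> R) (g : 'rV[R]_n.-1 -> 'rV[R]_n.-1),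
    \forall q \near p,
      chart_map c' q = (f (chart_map c q), g (chart_map c q).2).

Definition compatible (c c' : chart) : Prop :=
  foliated_change c c' /\ foliated_change c' c.

Record foliation := Foliation {
  atlas : set chart;
  atlas_foliated : forall c, atlas c -> foliated_chart c;
  atlas_cover : forall p : M, exists2 c, atlas c & chart_dom c p;
  atlas_compatible : forall c c', atlas c -> atlas c' -> compatible c c';
  atlas_maximal : forall c, foliated_chart c ->
    (forall c', atlas c' -> compatible c c') -> atlas c }.

Definition plaque (F : foliation) (P : set M) : Prop :=
  exists2 c, atlas F c
    & exists y, P = chart_dom c `&` [set p | (chart_map c p).2 = y].

(* A copy of [M] carrying the leaf topology, generated by the open subsets of
   plaques; leaves are its components, with the topology induced from it. *)
Definition leaf_space (F : foliation) : Type := M.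

HB.instance Definition _ F := Choice.on (leaf_space F).
HB.instance Definition _ F :=
  @isSubBaseTopological.Build (leaf_space F) (set M)
    [set A | exists P O, [/\ plaque F P, open O & A = P `&` O]] id.

Definition leaf (F : foliation) (L : set (leaf_space F)) : Prop :=
  exists x, L = connected_component [set: leaf_space F] x.

Definition long (F : foliation) (L : set (leaf_space F)) : Prop :=
  homeomorphic L (@long_ray R) \/ homeomorphic L [set: long_line R].

End Foliations.

Arguments leaf {R n M} F L.
Arguments long {R n M} F L.

(* Main.v *)
From HB Require Import structures.
Require Import Defs.
From mathcomp Require Import all_boot all_order all_algebra.
From mathcomp Require finmap.
From mathcomp Require Import all_classical all_reals.
From mathcomp Require Import topology normedtype wedge_sigT.
From mathcomp Require Import lra.

Set Implicit Arguments.
Unset Strict Implicit.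
Unset Printing Implicit Defensive.
Import Order.TTheory GRing.Theory Num.Theory numFieldNormedType.Exports.
Local Open Scope classical_set_scope.
Local Open Scope ring_scope.

(** Let [U] be the exhaustion of [M] provided by Type I, and for a countable
    ordinal [a] let [S a] be the saturation of the complement of the closure
    of [U a], that is, the set of the points whose leaf leaves that closure.
    The neighbourhood of [L] is the intersection [N] of all the [S a].

    Each [S a] is open, because a neighbourhood of a point slides along plaques
    ([saturation_nbhs]). It contains [L]: a long leaf cannot stay in a Lindelof
    subset of [M], since a continuous map from the long ray to a first countable
    Hausdorff space that stays in a Lindelof set is eventually constant
    ([long_ray_not_in_lindelof]). The sets [S a] decrease with [a]. Hence, if
    [x] is in [L] and [B] is a countable base at [x], each [S a] contains some
    [B k], one index [k] serves for cofinally many [a], and this [B k] is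
    contained in all the [S a]: so [N] is a neighbourhood of [x].

    A leaf that meets [N] is contained in no [U a], so it is not Lindelof for
    the leaf topology, and it remains to see that a connected Hausdorff
    one-manifold [X] that is not Lindelof is a long ray or a long line
    ([not_lindelof_long]). This is obtained by ordering [X]. An arc order
    is a linear order on a part of [X], its carrier, whose segments are real
    intervals and which is compatible with the topology. By Zorn's lemma
    there is a maximal one. If its carrier were not all of [X], an open arc
    would leave it at some point; the arc then follows a final or an initial
    segment of the order ([final_arcP]), so that the order can be prolonged
    ([arc_order_prolong]) unless the arc comes back to the carrier at once,
    in which case [X] is a circle, hence compact ([circle_compact]). So [X] carries an
    arc order ([maximal_arc_order]).

    If this order had countable cofinality in both directions, [X] would be
    a countable union of compact segments, hence Lindelof. In a direction of
    uncountable cofinality, a transfinite sequence of least upper bounds cuts the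
    order into copies of [0, 1) indexed by the countable ordinals, which
    makes it a closed long ray ([closed_long_ray_iso]). Two such directions
    give the long line. If there is only one, adjoining an end point
    in the other direction gives a closed long ray, so [X] is
    a long ray. *)

(** * Countable subsets of the first uncountable ordinal *)

Lemma omega1_lt_wf : well_founded (fun a b : omega1 => (a < b)%O).
Proof.
move=> a; apply: contrapT => na.
have [|m nm mmin] := @omega1_well_ordered [set b | ~ Acc (fun a b => (a < b)%O) b].
  by exists a.
apply: nm; constructor => b bm; apply: contrapT => /mmin.
by rewrite leNgt bm.
Qed.

Lemma omega1_countable_bounded (S : set omega1) :
  countable S -> exists b, forall s, S s -> (s < b)%O.
Proof.
move=> cS; apply: contrapT => nb; apply: omega1_uncountable.
apply: (@sub_countable _ _ _ (\bigcup_(s in S) [set b | (b <= s)%O])); last first.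
  by apply: bigcup_countable => // s _; exact: omega1_countable_segment.
apply: subset_card_le => b _; apply: contrapT => nSb; apply: nb.
exists b => s Ss; rewrite ltNge; apply/negP => bs; apply: nSb.
by exists s.
Qed.

Lemma omega1_seq_bounded (u : nat -> omega1) : exists b, forall k, (u k < b)%O.
Proof.
have [|b Hb] := @omega1_countable_bounded (range u).
  exact: sub_countable (card_image_le _ _) _.
by exists b => k; apply: Hb; exists k.
Qed.

(** Pigeonhole principle: if every fibre were bounded, a common strict bound of
    these countably many bounds would belong to no fibre. *)
Lemma omega1_cofinal_fibre (k : omega1 -> nat) :
  exists n, forall a, exists2 b, (a <= b)%O & k b = n.
Proof.
apply: contrapT => nn.
have bnd n : exists a, forall b, (a <= b)%O -> k b <> n.
  apply: contrapT => na; apply: nn; exists n => a; apply: contrapT => nb.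
  by apply: na; exists a => b ab kb; apply: nb; exists b.
have [u uP] := choice bnd.
have [b bP] := omega1_seq_bounded u.
exact: (uP (k b) b (ltW (bP _)) erefl).
Qed.

(** * Linear orders with real intervals *)

Section Orders.
Variables (R : realType) (Z : Type).
Implicit Types (G : set (Z * Z)) (a b c x y z : Z) (g : R -> Z).

(** Orders are encoded as sets of pairs, so that they are compared by inclusion,
    and the set they order is the one on which they are reflexive. *)
Definition carrier G : set Z := [set x | G (x, x)].

Record linear_on G : Prop := LinearOn {
  lin_carrier : forall x y, G (x, y) -> carrier G x /\ carrier G y;
  lin_trans : forall y x z, G (x, y) -> G (y, z) -> G (x, z);
  lin_anti : forall x y, G (x, y) -> G (y, x) -> x = y;
  lin_total : forall x y, carrier G x -> carrier G y -> G (x, y) \/ G (y, x) }.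

Definition unit_param G a b g :=
  [/\ g 0 = a, g 1 = b,
      forall s t : R, 0 <= s <= 1 -> 0 <= t <= 1 -> G (g s, g t) <-> s <= t
    & forall x, G (a, x) -> G (x, b) -> exists2 t : R, 0 <= t <= 1 & g t = x].

(** Density, completeness inside segments, and compactness and connectedness
    of segments are all read off these parametrisations. *)
Definition real_intervals G :=
  forall a b, G (a, b) -> a <> b -> exists g, unit_param G a b g.

Definition dual G : set (Z * Z) := [set p | G (p.2, p.1)].

Definition is_lub G (S : set Z) x :=
  [/\ carrier G x, forall s, S s -> G (s, x)
    & forall u, carrier G u -> (forall s, S s -> G (s, u)) -> G (x, u)].

(** Stated with strict bounds, so that it also excludes a greatest element. *)
Definition uncountable_cofinality G := forall C, C `<=` carrier G ->
  countable C -> exists2 y, carrier G y & forall c, C c -> ~ G (y, c).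

Lemma in01_0 : (0 : R) <= (0 : R) <= (1 : R). Proof. by rewrite lexx ler01. Qed.
Lemma in01_1 : (0 : R) <= (1 : R) <= (1 : R). Proof. by rewrite lexx ler01. Qed.
Hint Resolve in01_0 in01_1 : core.

Lemma lin_dual G : linear_on G -> linear_on (dual G).
Proof.
case=> c t a l; split.
- by move=> x y /c[].
- by move=> y x z /= xy yz; exact: t yz xy.
- by move=> x y xy yx; exact: a.
- by move=> x y cx cy; have [] := l _ _ cx cy; [right|left].
Qed.

Lemma real_intervals_dual G : real_intervals G -> real_intervals (dual G).
Proof.
move=> rG a b ab nab; have [|g [g0 g1 gi gs]] := rG b a ab; first exact: nesym.
exists (fun t => g (1 - t)); split.
- by rewrite subr0.
- by rewrite subrr.
- move=> s t s01 t01; rewrite /dual /=.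
  have := gi (1 - t) (1 - s); rewrite lerD2l lerN2; apply; lra.
- move=> x ax xb; have [t t01 <-] := gs x xb ax.
  by exists (1 - t); [lra|congr g; lra].
Qed.

Lemma lin_nle G x y : linear_on G -> carrier G x -> carrier G y ->
  ~ G (x, y) -> G (y, x).
Proof. by move=> lG cx cy; have [] := lin_total lG cx cy. Qed.

Lemma param_bounds G a b g t : unit_param G a b g -> 0 <= t <= 1 ->
  G (a, g t) /\ G (g t, b).
Proof.
by move=> [<- <- gi _] t01; split; apply/gi => //; case/andP: t01.
Qed.

(** The least upper bound is the image of a supremum taken in the unit
    interval that parametrises the segment from [s0] to [c]. *)
Lemma lub_exists G (S : set Z) s0 c : linear_on G -> real_intervals G ->
  S s0 -> (forall s, S s -> G (s, c)) -> exists x, is_lub G S x.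
Proof.
move=> lG rG Ss0 Sc; have s0c := Sc _ Ss0.
have [cs0 cc] := lin_carrier lG s0c.
have [E|ns0c] := pselect (s0 = c).
  by exists c; split => // u _ Su; rewrite -E; exact: Su.
have [g gP] := rG _ _ s0c ns0c; have [g0 g1 gi gs] := gP.
pose S' := [set t | 0 <= t <= 1 /\ exists2 s, S s & G (g t, s)].
have S'0 : S' 0 by split=> //; exists s0 => //; rewrite g0.
have ubS' : has_ubound S' by exists 1 => t [/andP[]].
have tau0 : 0 <= sup S' by exact: ub_le_sup.
have tau1 : sup S' <= 1.
  by apply: ge_sup; [exists 0|move=> t [/andP[]]].
have tau01 : 0 <= sup S' <= 1 by rewrite tau0.
have [s0tau tauc] := param_bounds gP tau01.
exists (g (sup S')); split; first by have [] := lin_carrier lG tauc.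
  move=> s Ss; have [cs _] := lin_carrier lG (Sc _ Ss).
  have [s0s|ss0] := lin_total lG cs0 cs; last exact: lin_trans lG _ _ _ ss0 s0tau.
  have [t t01 E] := gs _ s0s (Sc _ Ss); rewrite -E; apply/gi => //.
  by apply: ub_le_sup => //; split => //; exists s => //; rewrite E.
move=> u cu Su; have [uc|cu'] := lin_total lG cu cc; last first.
  exact: lin_trans lG _ _ _ tauc cu'.
have [t t01 E] := gs _ (Su _ Ss0) uc; rewrite -E; apply/gi => //.
apply: ge_sup; first by exists 0.
move=> r [r01 [s Ss grs]]; apply/gi => //.
by rewrite E; exact: lin_trans lG _ _ _ grs (Su _ Ss).
Qed.

Lemma affine_unit_param G (e : R -> Z) s t : s < t ->
  (forall u v, s <= u <= t -> s <= v <= t -> G (e u, e v) <-> u <= v) ->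
  (forall y, G (e s, y) -> G (y, e t) -> exists2 u, s <= u <= t & e u = y) ->
  unit_param G (e s) (e t) (fun r => e (s + r * (t - s))).
Proof.
move=> st ei es; have st' : 0 < t - s by rewrite subr_gt0.
have m r : 0 <= r <= 1 -> s <= s + r * (t - s) <= t.
  move=> /andP[r0 r1]; have := mulr_ge0 r0 (ltW st').
  have : 0 <= (1 - r) * (t - s) by apply: mulr_ge0; lra.
  by rewrite mulrBl mul1r; lra.
split.
- by rewrite mul0r addr0.
- by rewrite mul1r addrC subrK.
- move=> r r' r01 r'01; rewrite -(ler_pM2r st' r r') -(lerD2l s).
  by apply: ei; exact: m.
- move=> x sx xt; have [u /andP[su ut] <-] := es x sx xt.
  exists ((u - s) / (t - s)); last by rewrite divfK ?gt_eqF// addrC subrK.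
  by rewrite divr_ge0 ?ler_pdivrMr//; lra.
Qed.

Lemma unit_param_concat G a b c g1 g2 : linear_on G ->
  unit_param G a b g1 -> unit_param G b c g2 -> exists g, unit_param G a c g.
Proof.
move=> lG g1P g2P; have [g10 g11 g1i g1s] := g1P; have [g20 g21 g2i g2s] := g2P.
have le1 (t : R) : 0 <= t <= 1 -> t <= 2^-1 -> 0 <= 2 * t <= 1 by lra.
have gt1 (t : R) : 0 <= t <= 1 -> 2^-1 < t -> 0 <= 2 * t - 1 <= 1 by lra.
exists (fun t : R => if t <= 2^-1 then g1 (2 * t) else g2 (2 * t - 1)); split.
- by rewrite ifT ?mulr0// invr_ge0.
- by rewrite ifF; [rewrite mulr1 addrK|apply/negbTE; rewrite -ltNge; lra].
- move=> s t s01 t01; case: (leP s) => hs; case: (leP t) => ht.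
  + by rewrite (g1i _ _ (le1 _ s01 hs) (le1 _ t01 ht)); split; lra.
  + split => [_|_]; first by lra.
    apply: (@lin_trans _ lG b).
      by have [] := param_bounds g1P (le1 _ s01 hs).
    by have [] := param_bounds g2P (gt1 _ t01 ht).
  + split => [H|]; last by lra.
    have : G (g2 (2 * s - 1), g2 0).
      rewrite g20; apply: (lin_trans lG H).
      by have [] := param_bounds g1P (le1 _ t01 ht).
    by move=> /(g2i _ _ (gt1 _ s01 hs) in01_0); lra.
  + by rewrite (g2i _ _ (gt1 _ s01 hs) (gt1 _ t01 ht)); split; lra.
- move=> x ax xc; have [_ cx] := lin_carrier lG ax.
  have cb : carrier G b by rewrite /carrier /= -g20; apply/g2i.
  have [xb|bx] := lin_total lG cx cb.
    have [t t01 <-] := g1s x ax xb; exists (t / 2); first by lra.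
    by rewrite ifT; [congr g1; lra|lra].
  have [t t01 <-] := g2s x bx xc.
  have [t0|t0] := leP t 0; last first.
    exists ((t + 1) / 2); first by lra.
    rewrite ifF; first by congr g2; lra.
    by apply/negbTE; rewrite -ltNge; lra.
  have -> : t = 0 by lra.
  exists 2^-1; first by lra.
  have E : 2 * 2^-1 = 1 :> R by lra.
  by rewrite lexx E g11 g20.
Qed.

(** The ordinal sum of two orders: [N] is placed after [G]. *)
Definition lex_sum G N : set (Z * Z) :=
  [set p | [\/ G p, carrier G p.1 /\ carrier N p.2 | N p]].

Section LexSum.
Variables G N : set (Z * Z).
Hypotheses (lG : linear_on G) (lN : linear_on N).
Hypothesis disj : forall x, carrier G x -> ~ carrier N x.

Lemma lex_sum_carrier x : carrier (lex_sum G N) x -> carrier G x \/ carrier N x.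
Proof. by case=> [|[]|]; [left|left|right]. Qed.

Lemma lex_sum_left x y : lex_sum G N (x, y) -> carrier G y -> G (x, y).
Proof.
by case=> [//|[_ /= cy]|/(lin_carrier lN)[_ cy]] /disj; case.
Qed.

Lemma lex_sum_right x y : lex_sum G N (x, y) -> carrier N x -> N (x, y).
Proof.
by case=> [/(lin_carrier lG)[cx _]|[/= cx _]|//] /(disj cx).
Qed.

Lemma lin_lex_sum : linear_on (lex_sum G N).
Proof.
have GS x y : G (x, y) -> lex_sum G N (x, y) by exact: Or31.
have NS x y : N (x, y) -> lex_sum G N (x, y) by exact: Or33.
split.
- move=> x y [/(lin_carrier lG)[]|[/= cx cy]|/(lin_carrier lN)[]].
  + by move=> /GS ? /GS.
  + by split; [exact: GS|exact: NS].
  + by move=> /NS ? /NS.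
- move=> y x z xy; case=> [yz|[/= cy cz]|yz].
  + have [cy _] := lin_carrier lG yz.
    by apply: GS; exact: (lin_trans lG (lex_sum_left xy cy) yz).
  + by apply: Or32; split => //=; have [] := lin_carrier lG (lex_sum_left xy cy).
  + have [cy cz] := lin_carrier lN yz.
    have [xy'|[/= cx _]|xy'] := xy.
    * by have [_ /disj] := lin_carrier lG xy'.
    * by apply: Or32.
    * by apply: NS; exact: (lin_trans lN xy' yz).
- move=> x y xy yx; have [xy'|[/= cx cy]|xy'] := xy.
  + have [cx _] := lin_carrier lG xy'.
    exact: (lin_anti lG xy' (lex_sum_left yx cx)).
  + by have [/disj] := lin_carrier lG (lex_sum_left yx cx).
  + have [_ cy] := lin_carrier lN xy'.
    exact: (lin_anti lN xy' (lex_sum_right yx cy)).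
- move=> x y /lex_sum_carrier[cx|cx] /lex_sum_carrier[cy|cy].
  + by have [/GS|/GS] := lin_total lG cx cy; [left|right].
  + by left; apply: Or32.
  + by right; apply: Or32.
  + by have [/NS|/NS] := lin_total lN cx cy; [left|right].
Qed.

End LexSum.

End Orders.
Local Hint Resolve in01_0 in01_1 : core.

(** * Orders of uncountable cofinality and the closed long ray *)

Lemma closed_long_ray_leE (R : realType) (z w : closed_long_ray R) :
  (z <= w)%O = (z.1 <= w.1)%O && ((w.1 <= z.1)%O ==> (val z.2 <= val w.2)).
Proof. by rewrite -[LHS]/(@Order.le _ (omega1 *l Ico01 R)%type z w) leEprodlexi. Qed.

Section LongRay.
Variables (R : realType) (Z : Type) (G : set (Z * Z)) (x0 : Z).
Hypotheses (lG : linear_on G) (rG : real_intervals R G).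
Hypothesis Gx0 : forall y, carrier G y -> G (x0, y).
Hypothesis cx0 : carrier G x0.
Hypothesis unbounded : uncountable_cofinality G.

Lemma next_exists : exists nx : Z -> Z,
  forall y, carrier G y -> [/\ carrier G (nx y), G (y, nx y) & ~ G (nx y, y)].
Proof.
suff /choice[nx nxP] : forall y, exists z,
  carrier G y -> [/\ carrier G z, G (y, z) & ~ G (z, y)] by exists nx.
move=> y.
have [cy|ncy] := pselect (carrier G y); last by exists y.
have [||z cz zP] := @unbounded [set y].
- by move=> _ ->.
- exact: countable1.
by exists z => _; split; [|exact: lin_nle (zP _ erefl)|exact: zP].
Qed.

(** A countable set is bounded because the cofinality is uncountable; the empty
    set has [x0] as least upper bound. *)
Lemma countable_lub_exists : exists lub : set Z -> Z, forall S,
  S `<=` carrier G -> countable S -> is_lub G S (lub S).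
Proof.
suff /choice[lub lubP] : forall S, exists x,
  S `<=` carrier G -> countable S -> is_lub G S x by exists lub.
move=> S.
have [[SG cS]|nS] := pselect (S `<=` carrier G /\ countable S); last first.
  by exists x0 => SG cS; case: nS.
have [[s Ss]|S0] := pselect (S !=set0); last first.
  exists x0 => _ _; split => // [s Ss|u cu _]; last exact: Gx0.
  by case: S0; exists s.
have [c cc cP] := unbounded SG cS.
have [|x xP] := lub_exists (s0 := s) (c := c) lG rG Ss.
  by move=> t St; apply: lin_nle (cP _ St) => //; exact: SG.
by exists x.
Qed.

(** A continuous cofinal sequence [X] indexed by the countable ordinals: [X a]
    is the least upper bound of the points [nx (X b)], [b < a], where
    [X b < nx (X b)]. Defining [X] through [nx] makes the zero, successor
    and limit stages uniform, and the intervals from [X a] to [nx (X a)] tile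
    the order. *)
Lemma cofinal_tiling : exists X X' : omega1 -> Z,
  [/\ forall a, G (X a, X' a), forall a, ~ G (X' a, X a),
      forall a b, (a < b)%O -> G (X' a, X b)
    & forall y, carrier G y ->
      exists a, [/\ G (X a, y), G (y, X' a) & ~ G (X' a, y)]].
Proof.
have [nx nxP] := next_exists; have [lub lubP] := countable_lub_exists.
pose F (a : omega1) (rec : forall b : omega1, (b < a)%O -> Z) :=
  lub [set z | exists b, exists H : (b < a)%O, z = nx (rec b H)].
pose X := Fix omega1_lt_wf (fun _ => Z) F.
have XE a : X a = lub [set nx (X b) | b in [set b | (b < a)%O]].
  rewrite {1}/X Fix_eq; last first.
    move=> {}a f g fg; rewrite (_ : f = g) //.
    by apply: functional_extensionality_dep => b; apply/funext => p.
  congr lub; apply/seteqP; split => z.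
    by move=> [b [ba ->]]; exists b.
  by move=> [b ba <-]; exists b, ba.
have XP a : is_lub G [set nx (X b) | b in [set b | (b < a)%O]] (X a).
  elim/(well_founded_ind omega1_lt_wf): a => a IH; rewrite XE; apply: lubP.
    by move=> _ [b ba <-]; have [cb _ _] := IH b ba; have [] := nxP _ cb.
  apply: sub_countable (card_image_le _ _) _.
  apply: sub_countable (omega1_countable_segment a).
  by apply: subset_card_le => b /= /ltW.
have cX a : carrier G (X a) by case: (XP a).
have cX' a : carrier G (nx (X a)) by case: (nxP _ (cX a)).
have XX' a : G (X a, nx (X a)) by case: (nxP _ (cX a)).
have nX'X a : ~ G (nx (X a), X a) by case: (nxP _ (cX a)).
have X'X a b : (a < b)%O -> G (nx (X a), X b).
  by move=> ab; case: (XP b) => _ + _; apply; exists a.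
exists X, (nx \o X); split => // y cy.
have [a0 a0P] : exists a, ~ G (nx (X a), y).
  (* otherwise the disjoint intervals from X a to nx (X a) all lie below y,
     hence in a copy of [0, 1], and contain different rationals *)
  apply: contrapT => na.
  have {}na a : G (nx (X a), y) by apply: contrapT => H; apply: na; exists a.
  have x0y : x0 <> y.
    move=> E; apply: (nX'X omega1_0); apply: lin_trans (na _) _ => //.
    by rewrite -E; exact: Gx0.
  have [g [g0 g1 gi gs]] := rG (Gx0 cy) x0y.
  have sP a : exists t : R * R, [/\ 0 <= t.1 <= 1, 0 <= t.2 <= 1,
      g t.1 = X a & g t.2 = nx (X a)].
    have [|s s01 sE] := gs _ (Gx0 (cX a)).
      by apply: (lin_trans lG) (na a); exact: XX'.
    have [t t01 tE] := gs _ (Gx0 (cX' a)) (na a).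
    by exists (s, t).
  have [f fP] := choice sP.
  have f12 a : (f a).1 < (f a).2.
    have [f1 f2 E1 E2] := fP a.
    by rewrite ltNge; apply/negP => /(gi _ _ f2 f1); rewrite E1 E2; exact: nX'X.
  have f21 a b : (a < b)%O -> (f a).2 <= (f b).1.
    have [_ f2 _ E2] := fP a; have [f1 _ E1 _] := fP b.
    by move=> ab; apply/gi => //; rewrite E1 E2; exact: X'X.
  have [q qP] := choice (fun a => rat_in_itvoo (f12 a)).
  have q_mono a b : (a < b)%O -> q a < q b.
    move=> ab; rewrite -(ltr_rat R).
    have := qP a; have := qP b; rewrite !in_itv /=.
    move=> /andP[fq _] /andP[_ qf].
    exact: lt_le_trans qf (le_trans (f21 _ _ ab) (ltW fq)).
  apply: omega1_uncountable; apply/countable_injP.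
  exists (fun a => pickle (q a)) => a b _ _ /(pcan_inj pickleK) E.
  by have [/q_mono|/q_mono|//] := ltgtP a b; rewrite E ltxx.
(* the tile of y is the first one that ends strictly above y *)
have [|a na amin] := @omega1_well_ordered [set a | ~ G (nx (X a), y)].
  by exists a0.
exists a; split => //; last exact: (lin_nle lG (cX' a) cy na).
have [_ _] := XP a; apply => // _ [b ba <-].
by apply: contrapT => /amin; rewrite leNgt ba.
Qed.

(** The ordinal coordinate of a point selects a tile, and its real coordinate is
    the parameter in this tile; the right end of a tile belongs to a later tile,
    which is why the real coordinate ranges over [0, 1). *)
Lemma closed_long_ray_iso : exists h : closed_long_ray R -> Z,
  [/\ forall z, carrier G (h z), forall z w, G (h z, h w) <-> (z <= w)%O,
      forall y, carrier G y -> exists z, h z = y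
    & h (long_ray_origin R) = x0].
Proof.
have [X [X' [XX' nX'X X'X tile]]] := cofinal_tiling.
have gP a : exists g, unit_param (R := R) G (X a) (X' a) g.
  by apply: rG => // E; apply: (nX'X a); rewrite -E; have [] := lin_carrier lG (XX' a).
have {gP}[g gP] := choice gP.
pose h (z : closed_long_ray R) := g z.1 (val z.2).
have I01 (t : Ico01 R) : 0 <= val t <= 1.
  by have /andP[-> /ltW ->] := valP t.
have h_ge z : G (X z.1, h z) by have [] := param_bounds (gP z.1) (I01 z.2).
have h_le z : G (h z, X' z.1) by have [] := param_bounds (gP z.1) (I01 z.2).
have h_lt z : ~ G (X' z.1, h z).
  have [_ <- gi _] := gP z.1; move=> /gi => /(_ (in01_1 R) (I01 _)).
  by have /andP[_] := valP z.2; rewrite ltNge => /negP.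
have ch z : carrier G (h z) by have [] := lin_carrier lG (h_ge z).
have hi z w : G (h z, h w) <-> (z <= w)%O.
  case: z w => [a s] [b t]; rewrite closed_long_ray_leE /=.
  case: (ltgtP a b) => [ab|ba|ab] /=.
  - split => // _; apply: lin_trans (h_le _) _ => //=.
    by apply: (lin_trans lG (X'X _ _ ab)); exact: (h_ge (b, t)).
  - split => // H; case: (h_lt (b, t)) => /=.
    apply: (lin_trans lG (X'X _ _ ba)); apply: (lin_trans lG) H.
    exact: (h_ge (a, s)).
  - rewrite /h /= -ab; have [_ _ gi _] := gP a.
    exact: gi (I01 s) (I01 t).
have hs y : carrier G y -> exists z, h z = y.
  move=> cy; have [a [Xy yX' nX'y]] := tile y cy.
  have [_ g1 _ gs] := gP a; have [t /andP[t0 t1] E] := gs y Xy yX'.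
  have t1' : (0 <= t) && (t < 1).
    rewrite t0 lt_neqAle t1 andbT; apply/eqP => E1; apply: nX'y.
    by rewrite -E E1 g1; have [] := lin_carrier lG yX'; rewrite -E E1 g1.
  by exists (a, exist _ t t1').
exists h; split => //.
have [z zE] := hs _ cx0; apply: (lin_anti lG); last exact: Gx0.
rewrite -zE; apply/hi; case: z {zE} => a t; rewrite closed_long_ray_leE /=.
rewrite omega1_0P /=; apply/implyP => _.
by have /andP[] := valP t.
Qed.

End LongRay.

(** * Adjoining a least element to an order of countable coinitiality *)

Lemma countable_sequence (Z : Type) (C : set Z) (z0 : Z) : countable C ->
  exists e : nat -> Z, (forall n, C (e n) \/ e n = z0) /\
    forall c, C c -> exists n, e n = c.
Proof.
move=> /countable_injP[f finj].
have /choice[e eP] n : exists z,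
    (C z \/ z = z0) /\ forall c, C c -> f c = n -> z = c.
  have [[c Cc fc]|nc] := pselect (exists2 c, C c & f c = n).
    exists c; split; first by left.
    by move=> c' Cc' fc'; apply: finj; rewrite ?inE// fc fc'.
  by exists z0; split; [right|move=> c Cc fc; case: nc; exists c].
exists e; split=> [n|c Cc]; first by have [] := eP n.
by exists (f c); have [_] := eP (f c); exact.
Qed.

Section Bottom.
Variables (R : realType) (Z : Type) (G : set (Z * Z)) (C : set Z).
Hypotheses (lG : linear_on G) (rG : real_intervals R G).
Hypothesis no_least : forall y, carrier G y ->
  exists z, G (z, y) /\ ~ G (y, z).
Hypotheses (CG : C `<=` carrier G) (cC : countable C).
Hypothesis C_coinitial : forall y, carrier G y -> exists2 c, C c & G (c, y).

Lemma coinitial_sequence b : carrier G b -> exists d : nat -> Z,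
  [/\ d 0 = b, forall n, G (d n.+1, d n) /\ ~ G (d n, d n.+1)
    & forall y, carrier G y -> exists n, ~ G (y, d n)].
Proof.
move=> cb; have [e [eC eS]] := countable_sequence b cC.
have ce n : carrier G (e n) by have [/CG|->] := eC n.
have /choice[low lowP] (p : Z * Z) : exists z, carrier G p.1 -> carrier G p.2 ->
    [/\ carrier G z, G (z, p.1), ~ G (p.1, z), G (z, p.2) & ~ G (p.2, z)].
  case: p => x y /=.
  have [[cx cy]|nxy] := pselect (carrier G x /\ carrier G y); last first.
    by exists x => cx cy; case: nxy.
  have [xy|yx] := lin_total lG cx cy.
    have [z [zx nxz]] := no_least cx; exists z => _ _; split => //.
    - by have [] := lin_carrier lG zx.
    - exact: lin_trans lG _ _ _ zx xy.
    - by move=> yz; apply: nxz; exact: lin_trans lG _ _ _ xy yz.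
  have [z [zy nyz]] := no_least cy; exists z => _ _; split => //.
  - by have [] := lin_carrier lG zy.
  - exact: lin_trans lG _ _ _ zy yx.
  - by move=> xz; apply: nyz; exact: lin_trans lG _ _ _ yx xz.
pose d := fix d n := if n is m.+1 then low (d m, e m) else b.
have cd n : carrier G (d n).
  by elim: n => //= n IH; have [] := lowP (d n, e n) IH (ce n).
exists d; split => // [n|y cy].
  by have [] := lowP (d n, e n) (cd n) (ce n).
have [c Cc cy'] := C_coinitial cy; have [n nE] := eS c Cc.
exists n.+1 => H; have [_ _ _ _] := lowP (d n, e n) (cd n) (ce n); apply.
by apply: (lin_trans lG _ H); rewrite /= nE.
Qed.

(** Below [b], the order is a sequence of segments going down to the
    absent least element; gluing their parametrisations gives a copy
    of the half-open interval ]0, 1]. *)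
Lemma initial_segment_param b : carrier G b -> exists g : R -> Z,
  [/\ g 1 = b,
      forall s t, 0 < s <= 1 -> 0 < t <= 1 -> G (g s, g t) <-> s <= t
    & forall x, G (x, b) -> exists2 t, 0 < t <= 1 & g t = x].
Proof.
move=> cb; have [d [d0 dS dinf]] := coinitial_sequence cb.
have cd n : carrier G (d n) by have [/(lin_carrier lG)[]] := dS n.
have dmono m n : (m <= n)%N -> G (d n, d m).
  move=> /subnK <-; elim: (n - m)%N => [|k IH]; first exact: cd.
  by rewrite addSn; apply: lin_trans lG _ _ _ _ IH; case: (dS (k + m)%N).
have /choice[g gP] n : exists g, unit_param (R := R) G (d n.+1) (d n) g.
  have [H1 H2] := dS n; apply: rG => // E; apply: H2; rewrite -E.
  exact: cd.
pose N (t : R) := Num.truncn (t^-1 - 1).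
pose u (t : R) := (N t).+1%:R - (t^-1 - 1).
(* t in ]0, 1] corresponds to 1/t - 1 in [0, +oo[, whose integral part selects
   one of the consecutive intervals from d n.+1 to d n *)
have NP t : 0 < t <= 1 -> (N t)%:R <= t^-1 - 1 < (N t).+1%:R.
  move=> /andP[t0 t1]; apply: truncn_itv.
  by rewrite subr_ge0 invf_ge1.
have uP t : 0 < t <= 1 -> 0 < u t <= 1.
  by move=> /NP; rewrite /u -natr1; lra.
have uP' t : 0 < t <= 1 -> 0 <= u t <= 1 by move=> /uP/andP[/ltW -> ->].
pose h t := g (N t) (u t).
have h_gt t : 0 < t <= 1 -> ~ G (h t, d (N t).+1).
  move=> t01; have [<- _ gi _] := gP (N t).
  move=> /gi => /(_ (uP' _ t01) (in01_0 R)); rewrite leNgt.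
  by have /andP[->] := uP _ t01.
have h_le t : 0 < t <= 1 -> G (h t, d (N t)).
  by move=> t01; have [] := param_bounds (gP (N t)) (uP' _ t01).
have ch t : 0 < t <= 1 -> carrier G (h t).
  by move=> /h_le/(lin_carrier lG)[].
have h_lt s t : 0 < s <= 1 -> 0 < t <= 1 -> s < t -> ~ G (h t, h s).
  move=> s01 t01 st.
  have st' : t^-1 < s^-1 by rewrite ltf_pV2 ?posrE//; lra.
  have := NP _ s01; have := NP _ t01 => tN sN.
  have : (N t <= N s)%N by apply: le_truncn; lra.
  rewrite leq_eqVlt => /predU1P[E|lt]; last first.
    move=> H; apply: (h_gt _ t01); apply: (lin_trans lG H).
    exact: lin_trans lG _ _ _ (h_le _ s01) (dmono _ _ lt).
  rewrite /h E; have [_ _ gi _] := gP (N s).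
  by move=> /gi => /(_ (uP' _ t01) (uP' _ s01)); rewrite /u E; lra.
exists h; split.
- have -> : b = g 0%N 1 by have [_ ->] := gP 0%N.
  by rewrite /h /u /N invr1 subrr truncn0 subr0.
- move=> s t s01 t01; split.
    by move=> st; rewrite leNgt; apply/negP => /h_lt; exact.
  rewrite le_eqVlt => /predU1P[->|st]; first exact: ch.
  apply: (lin_nle lG (ch _ t01) (ch _ s01)); exact: h_lt.
- move=> x xb; have [cx _] := lin_carrier lG xb.
  have ex_n : exists n, `[< ~ G (x, d n.+1) >].
    have [n nx] := dinf x cx; exists n; apply/asboolP => H; apply: nx.
    by apply: (lin_trans lG H); case: (dS n).
  case: (ex_minnP ex_n) => n /asboolP nx nmin.
  have xn : G (x, d n).
    case: n nx nmin => [|n] nx nmin; first by rewrite d0.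
    apply: contrapT => H.
    by have /nmin : `[< ~ G (x, d n.+1) >]; [exact/asboolP|rewrite ltnn].
  have [g0 g1 gi gs] := gP n.
  have [|v /andP[v0 v1] vE] := gs x _ xn.
    exact: lin_nle (cd _) nx.
  have v0' : 0 < v.
    rewrite lt_neqAle v0 andbT eq_sym; apply/eqP => v00.
    by apply: nx; rewrite -vE v00 g0; exact: cd.
  have n1 : (1 : R) <= n%:R + 2 - v by have := ler0n R n; lra.
  exists (n%:R + 2 - v)^-1.
    by apply/andP; split; [rewrite invr_gt0|rewrite invf_le1]; lra.
  have NE : N (n%:R + 2 - v)^-1 = n.
    by apply: truncn_def; rewrite invrK -natr1; lra.
  rewrite /h /u NE invrK -vE; congr (g _ _).
  by rewrite -natr1; lra.
Qed.

(** The long ray is a closed long ray without its origin: adjoining a least element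
    reduces the case of countable coinitiality to that of orders with a least
    element. *)
Definition adjoin_bottom : set (option Z * option Z) :=
  [set p | match p with
           | (Some x, Some y) => G (x, y)
           | (None, Some y) => carrier G y
           | (None, None) => True
           | (Some _, None) => False
           end].

Lemma lin_adjoin_bottom : linear_on adjoin_bottom.
Proof.
split.
- move=> [x|] [y|] //=; first exact: (lin_carrier lG).
- move=> [y|] [x|] [z|] //=; first exact: (lin_trans lG).
  by move=> _ /(lin_carrier lG)[].
- by move=> [x|] [y|] //= xy yx; congr Some; exact: (lin_anti lG xy yx).
- by move=> [x|] [y|] //=; [exact: (lin_total lG)|right|left|left].
Qed.

Lemma real_intervals_adjoin_bottom : real_intervals R adjoin_bottom.
Proof.
move=> [a|] [b|] //= ab nab; last first.
  have [g [g1 gi gs]] := initial_segment_param ab.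
  exists (fun t => if t > 0 then Some (g t) else None); split.
  - by rewrite ltxx.
  - by rewrite ltr01 g1.
  - move=> s t s01 t01.
    case: ifPn => s0; case: ifPn => t0 /=.
    + by apply: gi; lra.
    + by split=> //; lra.
    + split; first by lra.
      by move=> _; apply/gi; lra.
    + by split=> //; lra.
  - move=> [x|] _ xb; last by exists 0; [exact: in01_0|rewrite ltxx].
    have [t /andP[t0 t1] <-] := gs _ xb.
    by exists t; [apply/andP; split; lra|rewrite t0].
have [|g [g0 g1 gi gs]] := rG ab; first by move=> E; apply: nab; rewrite E.
exists (Some \o g); split => /=; rewrite ?g0 ?g1 //.
by move=> [x|] //= ax xb; have [t t01 <-] := gs _ ax xb; exists t.
Qed.

End Bottom.

(** * Open arcs *)

Section Arcs.
Variables (R : realType).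

(** A homeomorphism from the real line onto an open subset, stated without
    mentioning its inverse. *)
Record open_arc (T : topologicalType) (e : R -> T) : Prop := Arc {
  arc_inj : injective e;
  arc_continuous : continuous e;
  arc_open : forall O, open O -> open (e @` O) }.

Lemma arc_comp (T : topologicalType) (e : R -> T) (f : R -> R) :
  open_arc e -> open_arc f -> open_arc (e \o f).
Proof.
move=> [ei ec eo] [fi fc fo]; split.
- exact: inj_comp.
- by move=> t; apply: continuous_comp; [exact: fc|exact: ec].
- by move=> O oO; rewrite -image_comp; apply: eo; exact: fo.
Qed.

(** Openness of the image of an open set is the continuity of the inverse. *)
Lemma arc_left_inverse (f g : R -> R) : cancel f g -> continuous f ->
  open (range f) -> (forall x, range f x -> {for x, continuous g}) -> open_arc f.
Proof.
move=> fK fc fo gc; split => //; first exact: can_inj fK.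
move=> O oO; rewrite openE => _ [t Ot <-].
have ft : range f (f t) by exists t.
have : \forall x \near f t, O (g x).
  by apply: gc => //; rewrite fK; exact: open_nbhs_nbhs.
have : \forall x \near f t, range f x by exact: open_nbhs_nbhs.
apply: filterS2 => x [s _ <-]; rewrite fK => Os.
by exists s.
Qed.

Lemma arc_translate (c : R) : open_arc (fun t : R => t + c).
Proof.
have c1 (a : R) : continuous (fun t : R => t + a).
  by move=> t; apply: cvgD; [exact: cvg_id|exact: cvg_cst].
apply: (@arc_left_inverse _ (fun t => t - c)) => //.
- by move=> t; rewrite addrK.
- suff -> : [set t + c | t in [set: R]] = setT by exact: openT.
  by apply/seteqP; split => // t _; exists (t - c) => //; rewrite subrK.
- by move=> x _; exact: (c1 (- c) x).
Qed.

Lemma arc_opp : open_arc (fun t : R => - t).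
Proof.
apply: (@arc_left_inverse _ (fun t => - t)) => //.
- by move=> t; rewrite opprK.
- by move=> t; apply: cvgN; exact: cvg_id.
- suff -> : [set - t | t in [set: R]] = setT by exact: openT.
  by apply/seteqP; split => // t _; exists (- t) => //; rewrite opprK.
- by move=> x _; apply: cvgN; exact: cvg_id.
Qed.

(** An affine image of the map t / (1 + |t|), whose inverse is x / (1 - |x|),
    translated at the source so that 0 is sent to [c]. *)
Lemma squash_itv (a b c : R) : a < c < b -> exists f : R -> R,
  [/\ open_arc f, f 0 = c, {mono f : s t / s <= t} & range f = `]a, b[%classic].
Proof.
move=> /andP[ac cb].
pose r := (b - a) / 2; pose m := (a + b) / 2.
have r0 : 0 < r by rewrite /r; lra.
have mr : m + r = b by rewrite /m /r; lra.
have mr' : m - r = a by rewrite /m /r; lra.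
pose f (t : R) := m + r * (t / (1 + `|t|)).
pose g (x : R) := ((x - m) / r) / (1 - `|(x - m) / r|).
have fK : cancel f g.
  move=> t; have t0 := normr_ge0 t.
  have H : 0 < 1 + `|t| by lra.
  have E : (f t - m) / r = t / (1 + `|t|).
    by rewrite /f addrAC subrr add0r mulrAC divff ?mul1r// gt_eqF.
  rewrite /g E normrM normfV (gtr0_norm H).
  have -> : 1 - `|t| / (1 + `|t|) = (1 + `|t|)^-1.
    by rewrite -[X in X - _](@divff _ (1 + `|t|)) ?gt_eqF// -mulrBl addrK mul1r.
  by rewrite invrK divfK ?gt_eqF.
have fmono : {mono f : s t / s <= t}.
  apply: le_mono => s t st; rewrite /f ltrD2l ltr_pM2l//.
  have s0 := normr_ge0 s; have t0 := normr_ge0 t.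
  rewrite ltr_pdivrMr ?ltr_pwDl// mulrAC ltr_pdivlMr ?ltr_pwDl//.
  rewrite !mulrDr !mulr1.
  have [s0'|s0'] := leP 0 s; have [t0'|t0'] := leP 0 t.
  - by rewrite !ger0_norm//; lra.
  - lra.
  - by rewrite (ltr0_norm s0') (ger0_norm t0'); nra.
  - by rewrite !ltr0_norm//; lra.
have fr : range f = `]a, b[%classic.
  apply/seteqP; split => x /=; rewrite in_itv /=.
    move=> [t _ <-]; rewrite /f -mr -mr'; have t0 := normr_ge0 t.
    have : `|t / (1 + `|t|)| < 1.
      rewrite normrM normfV (ger0_norm (_ : 0 <= 1 + `|t|)); last lra.
      by rewrite ltr_pdivrMr; lra.
    rewrite ltr_norml; set w := t / _ => /andP[h1 h2].
    have : 0 < r * (w + 1) by rewrite mulr_gt0//; lra.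
    have : 0 < r * (1 - w) by rewrite mulr_gt0//; lra.
    by rewrite mulrBr mulrDr mulr1; lra.
  move=> /andP[ax xb]; exists (g x) => //.
  have x1 : `|(x - m) / r| < 1.
    by rewrite ltr_norml ltr_pdivlMr// ltr_pdivrMr//; apply/andP; split; lra.
  rewrite /f /g; have yE : m + r * ((x - m) / r) = x.
    by rewrite mulrC divfK ?gt_eqF// addrC subrK.
  move: ((x - m) / r) x1 yE => y x1 yE.
  have y1 : 0 < 1 - `|y| by rewrite subr_gt0.
  rewrite normrM normfV (gtr0_norm y1) -[RHS]yE; congr (_ + _ * _).
  have -> : 1 + `|y| / (1 - `|y|) = (1 - `|y|)^-1.
    by rewrite -{1}(@divff _ (1 - `|y|)) ?gt_eqF// -mulrDl subrK mul1r.
  by rewrite invrK divfK ?gt_eqF.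
have gc (x : R) : range f x -> {for x, continuous g}.
  rewrite fr /= in_itv /= => /andP[ax xb].
  have c1 : {for x, continuous (fun x : R => (x - m) / r)}.
    by apply: cvgMl; apply: cvgB; [exact: cvg_id|exact: cvg_cst].
  apply: cvgM => //; apply: cvgV.
    rewrite gt_eqF// subr_gt0 ltr_norml ltr_pdivlMr// ltr_pdivrMr//.
    by apply/andP; split; lra.
  by apply: cvgB; [exact: cvg_cst|exact: cvg_norm].
have fc : continuous f.
  move=> t; apply: cvgD; first exact: cvg_cst.
  apply: cvgMr; apply: cvgM; first exact: cvg_id.
  apply: cvgV; first by rewrite gt_eqF// ltr_pwDl.
  by apply: cvgD; [exact: cvg_cst|apply: cvg_norm; exact: cvg_id].
have fa : open_arc f.
  by apply: arc_left_inverse fK fc _ gc; rewrite fr; exact: itv_open.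
exists (f \o (fun t => t + g c)); split.
- by apply: arc_comp fa _; exact: arc_translate.
- have [t _ tE] : range f c by rewrite fr /= in_itv /= ac.
  by rewrite /= add0r -tE fK.
- by move=> s t /=; rewrite fmono lerD2r.
- rewrite -fr; apply/seteqP; split => _ [t _ <-] /=; first by exists (t + g c).
  by exists (t - g c) => //=; rewrite subrK.
Qed.

End Arcs.

(** * Linear orders compatible with a topology *)

Section ArcOrders.
Variables (R : realType) (T : topologicalType).
Implicit Types (G : set (T * T)) (e : R -> T).

(** The order topology is the topology of [T]. This is expressed by the existence of
    monotone open arcs with convex ranges through all points, because this local
    form is stable under unions of chains. *)
Record arc_order G : Prop := ArcOrder {
  ao_linear : linear_on G;
  ao_real : real_intervals R G;
  ao_arc : forall a, carrier G a -> exists e, [/\ open_arc e, e 0 = a,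
    forall s t, G (e s, e t) <-> s <= t
    & forall s t y, G (e s, y) -> G (y, e t) -> exists u, e u = y] }.

Lemma arc_order_dual G : arc_order G -> arc_order (dual G).
Proof.
case=> lG rG aG; split; [exact: lin_dual|exact: real_intervals_dual|].
move=> a /aG[e [ea e0 ei es]]; exists (fun t => e (- t)); split.
- by apply: (arc_comp ea); exact: arc_opp.
- by rewrite oppr0.
- by move=> s t; rewrite /dual /= -lerN2; exact: ei.
- move=> s t y sy yt; have [u uE] := es _ _ _ yt sy.
  by exists (- u); rewrite opprK.
Qed.

Lemma arc_image_open e t V : open_arc e -> nbhs (t : R) V -> nbhs (e t) (e @` V).
Proof.
move=> [_ _ eo] NV.
have [O [oO Ot] OV] : exists2 O, open_nbhs t O & O `<=` V.
  by move: NV; rewrite nbhsE.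
apply: (@filterS _ _ _ (e @` O)); first exact: image_subset.
apply: open_nbhs_nbhs.
by split; [exact: eo|exists t].
Qed.

(** Around [y > a], an arc at [y] starts either above [a], or below it and then
    passes through [a] by convexity. *)
Lemma arc_order_upper_open G a : arc_order G -> carrier G a ->
  open [set y | G (a, y) /\ ~ G (y, a)].
Proof.
move=> [lG _ aG] ca; rewrite openE => y [ay nya].
have [_ cy] := lin_carrier lG ay; have [e [ea e0 ei es]] := aG y cy.
have ce t : carrier G (e t) by apply/ei.
have [s s0 sP] : exists2 s, s < 0 & G (a, e s).
  have [H|H] := lin_total lG ca (ce (-1)); first by exists (-1) => //; lra.
  rewrite -e0 in ay nya; have [u uE] := es _ _ _ H ay.
  rewrite -uE in nya *; exists u; last exact: ce.
  by rewrite ltNge; apply/negP => /ei.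
rewrite /interior -e0; apply: (@filterS _ _ _ (e @` `]s, +oo[)); last first.
  apply: arc_image_open => //; apply: open_nbhs_nbhs; split.
    exact: rray_open.
  by rewrite /= in_itv /= s0.
move=> _ [t + <-]; rewrite /= in_itv /= andbT => st; split.
  by apply: (lin_trans lG sP); apply/ei; exact: ltW.
by move=> H; move: (lin_trans lG H sP) => /ei; rewrite leNgt st.
Qed.

Lemma arc_order_lower_open G a : arc_order G -> carrier G a ->
  open [set y | G (y, a) /\ ~ G (a, y)].
Proof. by move=> /arc_order_dual; exact: arc_order_upper_open. Qed.

Lemma arc_order_open G : arc_order G -> open (carrier G).
Proof.
move=> [_ _ aG]; rewrite openE => a /aG[e [ea e0 ei _]].
rewrite /interior -e0; apply: (@filterS _ _ _ (e @` setT)).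
  by move=> _ [t _ <-]; apply/ei.
by apply: arc_image_open => //; exact: filterT.
Qed.

(** Otherwise the open rays above and below the missing point [y] would
    disconnect [C]. *)
Lemma connected_order_convex G (C : set T) a b y : arc_order G ->
  connected C -> C `<=` carrier G -> C a -> C b -> G (a, y) -> G (y, b) -> C y.
Proof.
move=> oG coC CG Ca Cb ay yb; apply: contrapT => nCy; have lG := ao_linear oG.
have [cy _] := lin_carrier lG yb.
have ny c : C c -> ~ (G (y, c) /\ G (c, y)).
  by move=> Cc [/(lin_anti lG) + cy']; move=> /(_ cy') E; apply: nCy; rewrite E.
pose U := [set z | G (y, z) /\ ~ G (z, y)].
pose V := [set z | G (z, y) /\ ~ G (y, z)].
have Ub : U b by split => // H; exact: (ny b Cb).
have /seteqP[_ E] : C `&` U = C.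
  apply: coC; first by exists b.
  - by exists U => //; exact: arc_order_upper_open.
  - exists (~` V); first by apply: open_closedC; exact: arc_order_lower_open.
    apply/seteqP; split => c [Cc]; first by move=> [yc ncy]; split => // -[].
    move=> nVc; split => //; have cc := CG _ Cc.
    have [yc|cy'] := lin_total lG cy cc.
      by split => // H; exact: (ny c Cc).
    by case: nVc; split => // H; exact: (ny c Cc).
by have [_ []] := E a Ca.
Qed.

(** An element [y] close to and below [h x] is either below all of [h @` B], or
    above some element of it and then in it by convexity; in the second case the
    elements of [B] near [x] are sent above [y]. *)
Lemma order_iso_continuous d (O : orderTopologicalType d) G (B : set O)
    (h : O -> T) : arc_order G ->
  (forall z w, B z -> B w -> G (h z, h w) <-> (z <= w)%O) ->
  (forall z w y, B z -> B w -> G (h z, y) -> G (y, h w) ->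
    exists2 v, B v & h v = y) ->
  {within B, continuous h}.
Proof.
move=> [lG _ aG] hi hs; apply/subspace_continuousP => x Bx.
suff : h @ within B (nbhs x) --> h x by [].
move=> V Vx.
have chB z : B z -> carrier G (h z) by move=> Bz; apply/hi.
have [e [ea e0 ei es]] := aG _ (chB _ Bx).
have ce t : carrier G (e t) by apply/ei.
have /nbhs_ballP[r /= r0 rV] : nbhs (0 : R) (e @^-1` V).
  by apply: (arc_continuous ea); rewrite e0.
pose q := r / 2.
have q0 : 0 < q by rewrite /q; lra.
suff : \forall z \near within B (nbhs x), G (e (- q), h z) /\ G (h z, e q).
  apply: filterS => z [H1 H2]; rewrite /preimage /=.
  have [u uE] := es _ _ _ H1 H2; rewrite -uE; apply: rV.
  move: H1 H2; rewrite -uE => /ei H1 /ei H2.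
  rewrite /ball /= sub0r normrN ltr_norml; apply/andP; split; rewrite /q in H1 H2; lra.
have eqx : G (e (- q), h x) by rewrite -e0; apply/ei; lra.
have xeq : G (h x, e q) by rewrite -e0; apply/ei; lra.
suff [lo up] : (\forall z \near within B (nbhs x), G (e (- q), h z)) /\
    (\forall z \near within B (nbhs x), G (h z, e q)).
  by apply: filterS2 lo up.
split; rewrite near_withinE.
- have [[w Bw weq]|nw] := pselect (exists2 w, B w & G (h w, e (- q))); last first.
    apply: nearW => z Bz.
    by apply: (lin_nle lG (chB _ Bz) (ce _)) => H; apply: nw; exists z.
  have [v Bv vE] := hs _ _ _ Bw Bx weq eqx.
  have vx : (v < x)%O.
    rewrite ltNge; apply/negP => /(hi _ _ Bx Bv).
    by rewrite vE -e0 => /ei; lra.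
  have : nbhs x `]v, +oo[%classic.
    by apply: open_nbhs_nbhs; split; [exact: rray_open|rewrite /= in_itv /= vx].
  apply: filterS => z; rewrite /= in_itv /= andbT => vz Bz.
  by rewrite -vE; apply/hi => //; exact: ltW.
- have [[w Bw weq]|nw] := pselect (exists2 w, B w & G (e q, h w)); last first.
    apply: nearW => z Bz.
    by apply: (lin_nle lG (ce _) (chB _ Bz)) => H; apply: nw; exists z.
  have [v Bv vE] := hs _ _ _ Bx Bw xeq weq.
  have vx : (x < v)%O.
    rewrite ltNge; apply/negP => /(hi _ _ Bv Bx).
    by rewrite vE -e0 => /ei; lra.
  have : nbhs x `]-oo, v[%classic.
    by apply: open_nbhs_nbhs; split; [exact: lray_open|rewrite /= in_itv /= vx].
  apply: filterS => z; rewrite /= in_itv /= => vz Bz.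
  by rewrite -vE; apply/hi => //; exact: ltW.
Qed.

(** Convexity of [B] says that a bound of [x] outside [B] bounds all of [B], so
    that only bounds in [B], whose images cut out open rays, matter. *)
Lemma order_iso_inverse_continuous d (O : orderTopologicalType d) G (B : set O)
    (h : O -> T) (k : T -> O) : arc_order G ->
  (forall z w v, B z -> B w -> (z <= v)%O -> (v <= w)%O -> B v) ->
  (forall z w, B z -> B w -> G (h z, h w) <-> (z <= w)%O) ->
  (forall z, B z -> k (h z) = z) ->
  {within h @` B, continuous k}.
Proof.
move=> oG cB hi kh; apply/subspace_continuousP => _ [x Bx <-].
suff : k @ within (h @` B) (nbhs (h x)) --> k (h x) by [].
move=> V.
have lG := ao_linear oG.
have chB z : B z -> carrier G (h z) by move=> Bz; apply/hi.
have lo w : (w < x)%O ->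
    \forall y \near within (h @` B) (nbhs (h x)), (w < k y)%O.
  move=> wx; rewrite near_withinE.
  have [Bw|nBw] := pselect (B w).
    have : nbhs (h x) [set y | G (h w, y) /\ ~ G (y, h w)].
      apply: open_nbhs_nbhs; split; first by apply: arc_order_upper_open; auto.
      by split; [apply/hi => //; exact: ltW|move/hi; rewrite leNgt wx; auto].
    apply: filterS => y [_ nw] [z Bz E]; move: nw; rewrite -E kh// => nw.
    by rewrite ltNge; apply/negP => zw; apply: nw; apply/hi.
  apply: nearW => _ [z Bz <-]; rewrite kh// ltNge; apply/negP => zw.
  by apply: nBw; apply: (cB z x) => //; exact: ltW.
have up w : (x < w)%O ->
    \forall y \near within (h @` B) (nbhs (h x)), (k y < w)%O.
  move=> wx; rewrite near_withinE.
  have [Bw|nBw] := pselect (B w).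
    have : nbhs (h x) [set y | G (y, h w) /\ ~ G (h w, y)].
      apply: open_nbhs_nbhs; split; first by apply: arc_order_lower_open; auto.
      by split; [apply/hi => //; exact: ltW|move/hi; rewrite leNgt wx; auto].
    apply: filterS => y [_ nw] [z Bz E]; move: nw; rewrite -E kh// => nw.
    by rewrite ltNge; apply/negP => zw; apply: nw; apply/hi.
  apply: nearW => _ [z Bz <-]; rewrite kh// ltNge; apply/negP => zw.
  by apply: nBw; apply: (cB x z) => //; exact: ltW.
rewrite kh// itv_nbhsE => -[i [io xi] iV].
suff : \forall y \near within (h @` B) (nbhs (h x)), k y \in i.
  by apply: filterS => y /iV.
case: i io xi {iV} => [[[] l|[]] [[] r|[]]] //= _; rewrite in_itv /=.
- by move=> /andP[/lo H1 /up H2]; near=> y; rewrite in_itv /=; apply/andP; split; near: y.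
- by rewrite andbT => /lo H; near=> y; rewrite in_itv /= andbT; near: y.
- by move=> /up H; near=> y; rewrite in_itv /=; near: y.
- by move=> _; near=> y; rewrite in_itv.
Unshelve. all: by end_near. Qed.

Definition segment G a b : set T := [set y | G (a, y) /\ G (y, b)].

Lemma segment_image G a b (g : R -> T) : unit_param G a b g ->
  segment G a b = g @` `[0, 1].
Proof.
move=> gP; apply/seteqP; split => y.
  move=> [ay yb]; have [_ _ _ gs] := gP; have [t t01 <-] := gs _ ay yb.
  by exists t => //=; rewrite in_itv.
by move=> [t + <-]; rewrite /= in_itv /= => t01; exact: (param_bounds gP t01).
Qed.

Lemma unit_param_continuous G a b (g : R -> T) : arc_order G ->
  unit_param G a b g -> {within `[0, 1], continuous g}.
Proof.
move=> oG gP; have [_ _ gi gs] := gP.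
apply: (order_iso_continuous oG) => z w; first by rewrite /= !in_itv /=; exact: gi.
move=> y; rewrite /= !in_itv /= => z01 w01 zy yw.
have [az _] := param_bounds gP z01; have [_ wb] := param_bounds gP w01.
have lG := ao_linear oG.
have [||t t01 <-] := gs y.
- exact: lin_trans lG _ _ _ az zy.
- exact: lin_trans lG _ _ _ yw wb.
by exists t => //=; rewrite in_itv.
Qed.

Lemma segment_connected_compact G a b : arc_order G -> G (a, b) ->
  connected (segment G a b) /\ compact (segment G a b).
Proof.
move=> oG ab; have lG := ao_linear oG.
have [E|nab] := pselect (a = b).
  rewrite (_ : segment G a b = [set a]).
    by split; [exact: connected1|exact: compact_set1].
  apply/seteqP; split => [y [ay yb]|_ ->] /=.
    by apply: (lin_anti lG _ ay); rewrite E.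
  by split; [have [] := lin_carrier lG ab|].
have [g gP] := ao_real oG ab nab; have gc := unit_param_continuous oG gP.
rewrite (segment_image gP); split.
  by apply: connected_continuous_connected gc; exact: segment_connected.
by apply: continuous_compact gc _; exact: segment_compact.
Qed.

Definition convex_in G G' :=
  [/\ G `<=` G',
      forall x y, carrier G x -> carrier G y -> G' (x, y) -> G (x, y)
    & forall a b y, carrier G a -> carrier G b -> G' (a, y) -> G' (y, b) ->
        carrier G y].

(** Because of this lemma inclusion alone is the right comparison of arc orders
    for Zorn's lemma: convexity is automatic, since the segments of [G] are
    connected. *)
Lemma arc_order_sub_convex G G' : arc_order G -> arc_order G' -> G `<=` G' ->
  convex_in G G'.
Proof.
move=> oG oG' GG'; have lG := ao_linear oG; have lG' := ao_linear oG'.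
have rs x y : carrier G x -> carrier G y -> G' (x, y) -> G (x, y).
  move=> cx cy xy; have [//|yx] := lin_total lG cx cy.
  by rewrite (lin_anti lG' xy (GG' _ yx)).
split=> // a b y ca cb ay yb.
have ab := rs _ _ ca cb (lin_trans lG' ay yb).
have sG : segment G a b `<=` carrier G by move=> z [/(lin_carrier lG)[]].
have [] // : segment G a b y.
apply: (connected_order_convex oG' _ _ _ _ ay yb).
- by have [] := segment_connected_compact oG ab.
- by move=> z /sG /GG'.
- by [].
- by [].
by move=> /(lin_carrier lG)[].
Qed.

Lemma unit_param_extend G G' a b (g : R -> T) : linear_on G -> convex_in G G' ->
  G (a, b) -> unit_param G a b g -> unit_param G' a b g.
Proof.
move=> lG [GG' rs cv] ab gP; have [g0 g1 gi gs] := gP.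
have [ca cb] := lin_carrier lG ab.
have cg t : 0 <= t <= 1 -> carrier G (g t).
  by move=> t01; have [_ /(lin_carrier lG)[]] := param_bounds gP t01.
split=> // [s t s01 t01|x ax xb].
  split; first by move=> st; apply/gi => //; apply: rs => //; exact: cg.
  by move=> /(gi _ _ s01 t01) /GG'.
by have cx := cv _ _ _ ca cb ax xb; apply: gs; exact: rs.
Qed.

Lemma monotone_arc_extend G G' e : linear_on G -> convex_in G G' ->
  (forall s t, G (e s, e t) <-> s <= t) ->
  (forall s t y, G (e s, y) -> G (y, e t) -> exists u, e u = y) ->
  (forall s t, G' (e s, e t) <-> s <= t) /\
  (forall s t y, G' (e s, y) -> G' (y, e t) -> exists u, e u = y).
Proof.
move=> lG [GG' rs cv] ei es; have ce t : carrier G (e t) by apply/ei.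
split=> [s t|s t y sy yt].
  by split; [move=> st; apply/ei; exact: rs|move=> /ei /GG'].
have cy := cv _ _ _ (ce s) (ce t) sy yt.
by apply: (es s t); exact: rs.
Qed.

Lemma arc_order_bigcup (F : set (set (T * T))) :
  F `<=` arc_order -> total_on F subset -> arc_order (\bigcup_(G in F) G).
Proof.
move=> Fo Ft; set U := \bigcup_(G in F) G.
have common p q : U p -> U q -> exists G, [/\ F G, G p & G q].
  move=> [G1 F1 p1] [G2 F2 q2].
  have [H|H] := Ft _ _ F1 F2; first by exists G2; split => //; exact: H.
  by exists G1; split => //; exact: H.
have lU : linear_on U.
  split.
  - move=> x y [G FG xy]; have [] := lin_carrier (ao_linear (Fo _ FG)) xy.
    by split; exists G.
  - move=> y x z /common H /H[G [FG xy yz]]; exists G => //.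
    exact: lin_trans (ao_linear (Fo _ FG)) _ _ _ xy yz.
  - move=> x y /common H /H[G [FG xy yx]].
    exact: lin_anti (ao_linear (Fo _ FG)) _ _ xy yx.
  - move=> x y /common H /H[G [FG cx cy]].
    by have [] := lin_total (ao_linear (Fo _ FG)) cx cy; [left|right]; exists G.
have conv G : F G -> convex_in G U.
  move=> FG; split; first exact: bigcup_sup.
  - move=> x y cx cy [G' FG' xy].
    have [H|H] := Ft _ _ FG FG'; last exact: H.
    have [_ rs _] := arc_order_sub_convex (Fo _ FG) (Fo _ FG') H.
    exact: rs.
  - move=> a b y ca cb /common H /H[G' [FG' ay yb]].
    have [lG lG'] := (ao_linear (Fo _ FG), ao_linear (Fo _ FG')).
    have [H'|H'] := Ft _ _ FG FG'.
      have [_ _ cv] := arc_order_sub_convex (Fo _ FG) (Fo _ FG') H'.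
      exact: cv ay yb.
    by have [_ /H'] := lin_carrier lG' ay.
split => //.
  move=> a b [G FG ab] nab; have [g gP] := ao_real (Fo _ FG) ab nab.
  exists g; apply: (unit_param_extend (ao_linear (Fo _ FG)) (conv _ FG)) => //.
move=> a [G FG ca]; have [e [ea e0 ei es]] := ao_arc (Fo _ FG) ca.
have [] := monotone_arc_extend (ao_linear (Fo _ FG)) (conv _ FG) ei es.
by exists e.
Qed.

Lemma arc_order_arc e : open_arc e ->
  arc_order [set p | exists s t, s <= t /\ p = (e s, e t)].
Proof.
move=> ea; have einj := arc_inj ea; set G := [set p | _].
have ei s t : G (e s, e t) <-> s <= t.
  split; last by move=> st; exists s, t.
  by move=> [s' [t' [st' [/einj -> /einj ->]]]].
have es x y : G (x, y) -> exists2 s, x = e s & exists t, y = e t.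
  by move=> [s [t [_ [-> ->]]]]; exists s => //; exists t.
split.
- split.
  + by move=> x y /es[s -> [t ->]]; split; apply/ei.
  + move=> y x z xy yz; have [t tE [u uE]] := es _ _ yz.
    have [s sE _] := es _ _ xy; move: xy yz; rewrite sE tE uE.
    by move=> /ei st /ei tu; apply/ei; exact: le_trans tu.
  + move=> x y xy; have [s sE [t tE]] := es _ _ xy; move: xy; rewrite sE tE.
    by move=> /ei st /ei ts; congr e; apply/eqP; rewrite eq_le st.
  + move=> x y /es[s -> _] /es[t -> _].
    by have [st|/ltW ts] := leP s t; [left|right]; apply/ei.
- move=> a b ab nab; have [s sE [t tE]] := es _ _ ab; subst a b.
  have st : s < t.
    move: ab => /ei st; rewrite lt_neqAle st andbT.
    by apply/eqP => E; apply: nab; rewrite E.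
  exists (fun r => e (s + r * (t - s))); apply: affine_unit_param => //.
  move=> x sx xt; have [u uE _] := es _ _ xt; subst x.
  by exists u => //; move: sx xt => /ei -> /ei ->.
- move=> a /es[s -> _]; exists (fun t => e (t + s)); split.
  + by apply: (arc_comp ea); exact: arc_translate.
  + by rewrite add0r.
  + by move=> u v; rewrite -(lerD2r s); exact: ei.
  + move=> u v y /es[_ _ [t ->]] _; exists (t - s).
    by rewrite subrK.
Qed.

End ArcOrders.

(** * Prolonging an arc order along an arc leaving its carrier *)

Section Prolongation.
Variables (R : realType) (T : topologicalType).
Hypothesis hT : hausdorff_space T.
Implicit Types (G : set (T * T)) (e : R -> T).

(** For times between [t0] and [b], the arc [e] runs through the final segment of
    [G] that starts at [e t0]. *)
Definition final_arc G e (t0 b : R) :=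
  (forall s t, t0 <= s < b -> t0 <= t < b -> G (e s, e t) <-> s <= t) /\
  (forall y, G (e t0, y) -> exists2 t, t0 <= t < b & e t = y).

(** Monotonicity: on the time interval [e] is injective and satisfies the
    intermediate value property, since connected sets are convex. Cofinality:
    otherwise the points [e t] would have a least upper bound in the carrier, to
    which [e t] would converge as [t] tends to [b], although it converges to [e b],
    which lies outside. *)
Lemma final_arcP G e (t0 t1 b : R) : arc_order R G -> open_arc e ->
  (forall t, t0 <= t < b -> carrier G (e t)) -> ~ carrier G (e b) ->
  t0 < t1 < b -> G (e t0, e t1) -> final_arc G e t0 b.
Proof.
move=> oG ea ec nb /andP[t01 t1b] G01; have lG := ao_linear oG.
have einj := arc_inj ea.
have ivt s t y : t0 <= s -> s <= t -> t < b ->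
    (G (e s, y) /\ G (y, e t)) \/ (G (e t, y) /\ G (y, e s)) ->
    exists2 u, s <= u <= t & e u = y.
  move=> t0s st tb H.
  have coI : connected (e @` `[s, t]).
    apply: connected_continuous_connected; first exact: segment_connected.
    exact/continuous_subspaceT/(arc_continuous ea).
  have cI : e @` `[s, t] `<=` carrier G.
    by move=> _ [u + <-]; rewrite /= in_itv /= => su; apply: ec; lra.
  have Is : (e @` `[s, t]) (e s) by exists s => //=; rewrite in_itv /= lexx st.
  have It : (e @` `[s, t]) (e t) by exists t => //=; rewrite in_itv /= lexx st.
  have [u + uE] : (e @` `[s, t]) y.
    case: H => -[H1 H2].
      exact: connected_order_convex oG coI cI Is It H1 H2.
    exact: connected_order_convex oG coI cI It Is H1 H2.
  by rewrite /= in_itv /= => su; exists u.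
(* [e t0 < e t1] fixes the direction: a reversal would make [e] take the value
   [e t0] a second time *)
have from_t0 t : t0 < t -> t < b -> G (e t0, e t).
  move=> t0t tb; apply: (lin_nle lG); [apply: ec; lra|apply: ec; lra|] => H.
  have [tt1|t1t|E] := ltgtP t t1.
  - by have [||||u ut /einj E] := ivt t t1 (e t0); [lra|lra|lra|left|lra].
  - by have [||||u ut /einj E] := ivt t1 t (e t0); [lra|lra|lra|right|lra].
  - move: H; rewrite E => H; have /einj := lin_anti lG H G01; lra.
have incr s t : t0 <= s -> s < t -> t < b -> G (e s, e t).
  move=> t0s st tb; apply: (lin_nle lG); [apply: ec; lra|apply: ec; lra|] => H.
  move: t0s; rewrite le_eqVlt => /predU1P[E|t0s].
    rewrite -E in st H; have /einj := lin_anti lG H (from_t0 _ st tb); lra.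
  have t0t : G (e t0, e t) by apply: from_t0; lra.
  by have [||||u ut /einj E] := ivt t0 s (e t); [lra|lra|lra|left|lra].
have mono s t : t0 <= s < b -> t0 <= t < b -> G (e s, e t) <-> s <= t.
  move=> sb tb; split=> [H|].
    rewrite leNgt; apply/negP => ts.
    have ts' : G (e t, e s) by apply: incr; lra.
    by have /einj := lin_anti lG H ts'; lra.
  rewrite le_eqVlt => /predU1P[->|st]; first exact: ec.
  by apply: incr => //; lra.
split=> // y t0y; have [_ cy] := lin_carrier lG t0y.
have t0b : t0 < b by lra.
have [[t tb yt]|nt] := pselect (exists2 t, t0 <= t < b & G (y, e t)).
  have [||||u ut uE] := ivt t0 t y; [lra|lra|lra|by left|].
  by exists u => //; lra.
(* otherwise [e] would converge at b to a least upper bound inside the carrier *)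
have {}nt t : t0 <= t < b -> G (e t, y) /\ ~ G (y, e t).
  move=> tb; have nyt : ~ G (y, e t) by move=> H; apply: nt; exists t.
  by split=> //; apply: (lin_nle lG cy) => //; exact: ec.
pose S := [set e t | t in [set t | t0 <= t < b]].
have [||x [cx xub xlub]] := @lub_exists _ _ G S (e t0) y lG (ao_real oG).
- by exists t0 => //=; rewrite lexx.
- by move=> _ [t /= tb <-]; have [] := nt t tb.
case: nb; suff -> : e b = x by [].
apply: hT => A B /= Ab Bx.
have [f [fa f0 fi fs]] := ao_arc oG cx.
have /nbhs_ballP[d /= d0 dB] : nbhs (0 : R) (f @^-1` B).
  by apply: (arc_continuous fa); rewrite f0.
have /nbhs_ballP[r /= r0 rA] : nbhs b (e @^-1` A) by exact: (arc_continuous ea).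
have cf t : carrier G (f t) by apply/fi.
have [t tb ft] : exists2 t, t0 <= t < b & G (f (- (d / 2)), e t).
  apply: contrapT => nf.
  have : G (x, f (- (d / 2))).
    apply: xlub => // _ [t /= tb <-]; apply: (lin_nle lG) => //; first exact: ec.
    by move=> H; apply: nf; exists t.
  by rewrite -f0 => /fi; lra.
have [u [ub tu bu]] : exists u, [/\ t0 <= u < b, t <= u & b - u < r].
  have [H|H] := leP t (b - r / 2).
    by exists (b - r / 2); split; lra.
  by exists t; split; lra.
have ux : G (e u, x) by apply: xub; exists u.
exists (e u); split.
  by apply: rA; rewrite /ball /= ger0_norm; lra.
rewrite -f0 in ux; have fu : G (f (- (d / 2)), e u).
  by apply: (lin_trans lG ft); apply/mono.
have [v vE] := fs _ _ _ fu ux; rewrite -vE; apply: dB.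
move: fu ux; rewrite -vE => /fi H1 /fi H2.
by rewrite /ball /= ger0_norm; lra.
Qed.

(** The order is continued after its final segment by the part of the
    arc that lies outside the carrier. *)
Lemma arc_order_prolong G e (t0 d : R) : arc_order R G -> open_arc e ->
  t0 < 0 -> 0 < d -> final_arc G e t0 0 ->
  (forall s, 0 <= s < d -> ~ carrier G (e s)) ->
  exists G', [/\ arc_order R G', G `<=` G', carrier G' (e 0)
    & carrier G' `<=` carrier G `|` range e].
Proof.
move=> oG ea t00 d0 [mono fin] out; have [lG rG aG] := oG.
have einj := arc_inj ea.
(* the order carried by the new points *)
pose N := [set p | exists s t, [/\ 0 <= s, s <= t, t < d & p = (e s, e t)]].
have NP x y : N (x, y) -> exists s t, [/\ 0 <= s, s <= t, t < d, x = e s & y = e t].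
  by move=> [s [t [s0 st td [-> ->]]]]; exists s, t.
have Ne s t : 0 <= s < d -> 0 <= t < d -> N (e s, e t) <-> s <= t.
  move=> sd td; split; first by move=> /NP[s' [t' [_ st _ /einj -> /einj ->]]].
  by move=> st; exists s, t; split => //; lra.
have cN t : 0 <= t < d -> carrier N (e t) by move=> td; apply/Ne.
have cNP y : carrier N y -> exists2 t, 0 <= t < d & y = e t.
  by move=> /NP[s [t [s0 st td _ ->]]]; exists t => //; lra.
have lN : linear_on N.
  split.
  - by move=> x y /NP[s [t [s0 st td -> ->]]]; split; apply: cN; lra.
  - move=> y x z /NP[s [t [s0 st td -> ->]]] /NP[u [v [u0 uv vd /einj E ->]]].
    by apply/Ne; lra.
  - move=> x y /NP[s [t [s0 st td -> ->]]] ts; congr e.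
    have : t <= s by apply/Ne => //; lra.
    lra.
  - move=> x y /cNP[s sd ->] /cNP[t td ->].
    by have [st|/ltW ts] := leP s t; [left|right]; apply/Ne.
have disj x : carrier G x -> ~ carrier N x
  by move=> cx /cNP[t td xE]; move: cx; rewrite xE; exact: out.
pose G' := lex_sum G N; have lG' : linear_on G' := lin_lex_sum lG lN disj.
have cv : convex_in G G'.
  split; first by move=> p Gp; exact: Or31.
  - by move=> x y _ cy xy; exact: (lex_sum_left lN disj xy).
  - move=> a b y _ cb _ yb.
    by have [] := lin_carrier lG (lex_sum_left lN disj yb cb).
have ce s : t0 <= s < 0 -> carrier G (e s) by move=> s0; apply/mono.
have ce' s : t0 <= s < d -> carrier G' (e s).
  move=> sd; have [s0|s0] := ltP s 0; first by apply: Or31; apply: ce; lra.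
  by apply: Or33; apply: cN; lra.
have incr s t : t0 <= s -> s <= t -> t < d -> G' (e s, e t).
  move=> t0s st td; have [s0|s0] := ltP s 0; have [t0'|t0'] := ltP t 0.
  - by apply: Or31; apply/mono; lra.
  - by apply: Or32; split; [apply: ce; lra|apply: cN; lra].
  - lra.
  - by apply: Or33; apply/Ne; lra.
have mono' s t : t0 <= s < d -> t0 <= t < d -> G' (e s, e t) <-> s <= t.
  move=> sd td; split=> [H|st]; last by apply: incr; lra.
  rewrite leNgt; apply/negP => ts; have ts' : G' (e t, e s) by apply: incr; lra.
  by have /einj := lin_anti lG' H ts'; lra.
have fin' y : G' (e t0, y) -> exists2 u, t0 <= u < d & e u = y.
  have ct0 : carrier G (e t0) by apply: ce; lra.
  move=> t0y; have [_ cy'] := lin_carrier lG' t0y.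
  have [cy|/cNP[t td ->]] := lex_sum_carrier cy'.
    have [u u0 <-] := fin y (lex_sum_left lN disj t0y cy).
    by exists u => //; lra.
  by exists t => //; lra.
have param s t : t0 <= s -> s < t -> t < d ->
    exists g : R -> T, unit_param G' (e s) (e t) g.
  move=> t0s st td; exists (fun r => e (s + r * (t - s))).
  apply: affine_unit_param => //; first by move=> u v su vs; apply: mono'; lra.
  move=> y sy yt; have [|u ud uE] := fin' y.
    by apply: (lin_trans lG') sy; apply: incr; lra.
  by exists u => //; move: sy yt; rewrite -uE => /mono' H /mono' H'; apply/andP;
    split; [apply: H|apply: H']; lra.
have arc_at s : t0 < s < d -> exists f : R -> T, [/\ open_arc f, f 0 = e s,
    forall u v, G' (f u, f v) <-> u <= v
    & forall u v y, G' (f u, y) -> G' (y, f v) -> exists w, f w = y].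
  move=> /squash_itv[f [fa f0 fm fr]].
  have fd u : t0 < f u < d.
    have : range f (f u) by exists u.
    by rewrite fr /= in_itv.
  exists (e \o f); split => /=; first exact: arc_comp.
  - by rewrite f0.
  - by move=> u v; have := fd u; have := fd v => vd ud; rewrite mono' ?fm//; lra.
  - move=> u v y uy yv; have := fd u; have := fd v => vd ud.
    have [|w wd wE] := fin' y; first by apply: (lin_trans lG') uy; apply: incr; lra.
    have [x _ xE] : range f w.
      rewrite fr /= in_itv /=; move: uy; rewrite -wE => /mono' uw.
      by apply/andP; split; [have : f u <= w by apply: uw; lra|]; lra.
    by exists x; rewrite xE.
exists G'; split.
- split => //.
  + move=> a b ab nab; have [ca cb] := lin_carrier lG' ab.
    have [cb'|/cNP[t td bE]] := lex_sum_carrier cb.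
      have ab' := lex_sum_left lN disj ab cb'.
      have [g gP] := rG _ _ ab' nab.
      by exists g; exact: (unit_param_extend lG cv ab' gP).
    rewrite bE in ab nab *.
    have ct0 : carrier G (e t0) by apply: ce; lra.
    have [t0a|at0] := lin_total lG' (ce' t0 ltac:(lra)) ca.
      have [s sd sE] := fin' a t0a; rewrite -sE in ab nab *.
      apply: param; [lra| |lra]; move: ab => /mono' st.
      rewrite lt_neqAle st ?andbT; try lra.
      by apply/eqP => E; apply: nab; rewrite E.
    have at0' := lex_sum_left lN disj at0 ct0.
    have [E|na] := pselect (a = e t0); first by rewrite E; apply: param; lra.
    have [g1 g1P] := rG _ _ at0' na.
    have [|||g2 g2P] := param t0 t; [lra|lra|lra|].
    exact: (unit_param_concat lG' (unit_param_extend lG cv at0' g1P) g2P).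
  + move=> a ca'; have [ca|/cNP[s sd ->]] := lex_sum_carrier ca'; last first.
      by apply: arc_at; lra.
    have [f [fa f0 fi fs]] := aG a ca.
    by have [] := monotone_arc_extend lG cv fi fs; exists f.
- by move=> p Gp; exact: Or31.
- by apply: ce'; lra.
- move=> x cx'; have [cx|/cNP[t _ ->]] := lex_sum_carrier cx'; first by left.
  by right; exists t.
Qed.

End Prolongation.

(** * Compact and Lindelof sets *)

Section CompactLindelof.
Import finmap.

(** A point of [K] makes the space pointed, so that compactness can be expressed by
    finite subcovers. *)
Lemma compact_lindelof (T : topologicalType) (K : set T) :
  compact K -> lindelof K.
Proof.
move=> cK C oC KC.
have [[x0 Kx0]|K0] := pselect (K !=set0); last first.
  by exists set0; split => // x Kx; case: K0; exists x.
pose P : ptopologicalType := HB.pack (T : Type) (isPointed.Build T x0) (Topological.on T).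
have : @cover_compact P K by rewrite -compact_cover; exact: cK.
move=> /(_ (set T) C id) [//|//|D DC KD].
exists [set` D]; split.
- by move=> O /DC /set_mem.
- exact/finite_set_countable/finite_fset.
- by move=> x /KD.
Qed.

End CompactLindelof.

Lemma lindelof_bigcup (T : topologicalType) I (D : set I) (A : I -> set T) :
  countable D -> (forall i, D i -> lindelof (A i)) ->
  lindelof (\bigcup_(i in D) A i).
Proof.
move=> cD lA C oC AC.
have /choice[F FP] i : exists C', D i ->
    [/\ C' `<=` C, countable C' & A i `<=` \bigcup_(O in C') O].
  have [Di|nDi] := pselect (D i); last by exists set0.
  have [|C' C'P] := lA i Di C oC; last by exists C'.
  by apply: subset_trans AC; exact: bigcup_sup.
exists (\bigcup_(i in D) F i); split.
- by move=> O [i Di FO]; have [+ _ _] := FP i Di; exact.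
- by apply: bigcup_countable => // i Di; have [] := FP i Di.
- move=> x [i Di Ax]; have [_ _ /(_ x Ax)[O FO Ox]] := FP i Di.
  by exists O => //; exists i.
Qed.

(** * The carrier of a maximal arc order *)

Section Maximal.
Variables (R : realType) (T : topologicalType).
Hypothesis hT : hausdorff_space T.
Implicit Types (G : set (T * T)) (e : R -> T).

(** The first exit time is the infimum of the times spent outside of [A]; this set
    of times is closed because [A] is open. *)
Lemma exit_time (e : R -> T) (A : set T) (r s : R) : continuous e -> open A ->
  r < s -> A (e r) -> ~ A (e s) ->
  exists b, [/\ r < b <= s, forall t, r <= t < b -> A (e t) & ~ A (e b)].
Proof.
move=> ce oA rs Ar nAs; pose S := [set t | r <= t /\ ~ A (e t)].
have Ss : S s by split => //; exact: ltW.
have lS : has_lbound S by exists r => t [].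
have leS t : S t -> inf S <= t by exact: (ge_inf lS).
have iS : has_inf S by split => //; exists s.
have nAb : ~ A (e (inf S)).
  move=> Ab; have /nbhs_ballP[d /= d0 dA] : nbhs (inf S) (e @^-1` A).
    by apply: ce; exact: open_nbhs_nbhs.
  have [t St tb] := inf_adherent d0 iS; have bt := leS t St; case: St => _.
  apply; apply: dA; rewrite /ball /= distrC ger0_norm; first by lra.
  by rewrite subr_ge0.
exists (inf S); split => //.
- rewrite (leS _ Ss) andbT lt_neqAle; apply/andP; split.
    by apply/eqP => E; apply: nAb; rewrite -E.
  by apply: lb_le_inf; [exists s|move=> t []].
- move=> t /andP[rt tb]; apply: contrapT => nAt.
  by move: tb; rewrite ltNge leS.
Qed.

Section Step.
Variables (G : set (T * T)) (X : set T) (e : R -> T) (t0 : R).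
Hypotheses (oG : arc_order R G) (GX : carrier G `<=` X) (coX : connected X).
Hypotheses (ea : open_arc e) (eX : range e `<=` X) (t00 : t0 < 0).
Hypothesis fin : final_arc G e t0 0.
Hypothesis ne0 : ~ carrier G (e 0).

Let f (t : R) := e (- t).

Let fa : open_arc f. Proof. exact: (arc_comp ea (arc_opp R)). Qed.

(** Where the arc [e] comes back to the carrier, it does so along an initial
    segment, the final one being already taken by negative times. *)
Lemma return_initial u0 : 0 < u0 -> carrier G (e u0) ->
  exists2 b, - u0 < b <= 0 & final_arc (dual G) f (- u0) b.
Proof.
have t0n := t00; move=> u00 cu0; have lG := ao_linear oG; have einj := arc_inj ea.
have fu0 : f (- u0) = e u0 by rewrite /f opprK.
have [|||b [b1 b2 b3]] := @exit_time f (carrier G) (- u0) 0 (arc_continuous fa)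
  (arc_order_open oG).
- by lra.
- by rewrite fu0.
- by rewrite /f oppr0.
exists b => //; pose t1 := (b - u0) / 2.
have t1b : - u0 < t1 < b by rewrite /t1; lra.
have t1b' : - u0 <= t1 < b by lra.
have [H|H] := lin_total lG (b2 (- u0) ltac:(lra)) (b2 t1 t1b'); last first.
  by apply: (final_arcP hT (arc_order_dual oG) fa b2 b3 t1b).
have [mono' fin'] := final_arcP hT oG fa b2 b3 t1b H.
have [mono fin0] := fin.
have ct0 : carrier G (e t0) by apply/mono; lra.
have [K|K] := lin_total lG ct0 cu0.
  by have [t tt /einj] := fin0 _ K; lra.
rewrite -fu0 in K; have [t tt /einj] := fin' _ K; lra.
Qed.

(** If the arc returns to the carrier immediately after time 0, it follows
    an initial segment of the order up to this time. Then the final and the initial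
    segments are joined at [e 0], and the carrier with this point is
    the union of the images of two compact intervals; being open and closed, it is
    all of [X]. *)
Lemma circle_compact : (forall d, 0 < d -> exists2 s, 0 <= s < d & carrier G (e s)) ->
  compact X.
Proof.
have t0n := t00; move=> ret; have lG := ao_linear oG; have einj := arc_inj ea.
have ret' d : 0 < d -> exists2 s, 0 < s < d & carrier G (e s).
  move=> /ret[s sd cs]; exists s => //.
  have : s != 0 by apply/eqP => s0; apply: ne0; rewrite -s0.
  by case/andP: sd => s0 sd; rewrite lt_neqAle eq_sym => ->; rewrite s0 sd.
have [u0 /andP[u00 _] cu0] := ret' 1 ltr01.
have [b b0 fb] := return_initial u00 cu0; have [mono' fin'] := fb.
(* if b were negative, an earlier return would give another initial segment
   of the order, and two initial segments meet *)
have {}b0 : b = 0.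
  apply/eqP; rewrite eq_le; apply/andP; split; first lra.
  rewrite leNgt; apply/negP => bn.
  have [|u1 u1b cu1] := ret' (- b); first lra.
  have [|b1 b1u [mono1 fin1]] := return_initial _ cu1; first lra.
  have [K|K] := lin_total (lin_dual lG) cu0 cu1.
    rewrite -(opprK u0) in K; have [t tt /einj E] := fin' _ K; lra.
  rewrite -(opprK u1) in K; have [t tt /einj E] := fin1 _ K; lra.
subst b; have [mono fin0] := fin.
have ct0 : carrier G (e t0) by apply/mono; lra.
have u0t0 : G (e u0, e t0).
  apply: (lin_nle lG ct0 cu0) => /fin0[t tt /einj]; lra.
pose K := e @` `[t0, u0] `|` segment G (e u0) (e t0).
have KE : K = carrier G `|` [set e 0].
  apply/seteqP; split => x.
    case=> [[t + <-]|[/(lin_carrier lG)[_ cx] _]]; last by left.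
    rewrite /= in_itv /= => /andP[t0t tu0].
    have [tn|tp|->] := ltgtP t 0; last by right.
      by left; apply/mono; lra.
    left; have : carrier (dual G) (f (- t)) by apply/mono'; lra.
    by rewrite /f opprK.
  case=> [cx|->]; last by left; exists 0 => //=; rewrite in_itv /=; lra.
  have [/fin0[t tt <-]|xt0] := lin_total lG ct0 cx.
    by left; exists t => //=; rewrite in_itv /=; lra.
  have [u0x|xu0] := lin_total lG cu0 cx; first by right.
  have [|t tt <-] := fin' x; first by rewrite /f opprK.
  by left; exists (- t) => //=; rewrite in_itv /=; lra.
have cK : compact K.
  apply: compactU; last by have [] := segment_connected_compact oG u0t0.
  apply: continuous_compact; last exact: segment_compact.
  exact/continuous_subspaceT/(arc_continuous ea).
have KX : K `<=` X.
  by rewrite KE => x [/GX//|->]; apply: eX; exists 0.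
(* open, because the ends of the two compact intervals lie in the carrier *)
have oK : open K.
  have -> : K = carrier G `|` e @` `]t0, u0[.
    rewrite {1}KE; apply/seteqP; split => x [cx|]; try by left.
      by move=> ->; right; exists 0 => //=; rewrite in_itv /=; lra.
    move=> [t + <-]; rewrite /= in_itv /= => tt.
    suff : K (e t) by rewrite KE.
    by left; exists t => //=; rewrite in_itv /=; lra.
  apply: openU; first exact: arc_order_open oG.
  by apply: (arc_open ea); exact: itv_open.
suff <- : K = X by [].
apply: coX; first by exists (e 0); rewrite KE; right.
- by exists K => //; apply/esym/setIidPr.
- by exists K; [exact: compact_closed|apply/esym/setIidPr].
Qed.

Lemma prolong_or_compact : compact X \/
  exists G', [/\ arc_order R G', G `<=` G', carrier G' (e 0)
    & carrier G' `<=` X].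
Proof.
have [[d d0 nd]|nd] := pselect (exists2 d, 0 < d &
    forall s, 0 <= s < d -> ~ carrier G (e s)).
  right; have [G' [o1 o2 o3 o4]] := arc_order_prolong oG ea t00 d0 fin nd.
  by exists G'; split => // x /o4[/GX|/eX].
left; apply: circle_compact => d d0; apply: contrapT => ns; apply: nd.
by exists d => // s sd cs; apply: ns; exists s.
Qed.

End Step.

(** A point of [X] outside the carrier but in its closure would give an arc that
    exits the carrier, along which the order, or its dual, could be prolonged. *)
Theorem maximal_arc_order (X : set T) : connected X -> X !=set0 ->
  (forall x, X x -> exists e : R -> T, [/\ open_arc e, e 0 = x & range e `<=` X]) ->
  ~ compact X -> exists2 G, arc_order R G & carrier G = X.
Proof.
move=> coX [x0 Xx0] Xarc nK.
have [|A [[oA AX] Amax]] := @Zorn_bigcup _ (fun G => arc_order R G /\ carrier G `<=` X).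
  move=> F FP Ft; split; first by apply: arc_order_bigcup => // G /FP[].
  by move=> x [G FG Gx]; have [_] := FP G FG; apply.
have ext G' : arc_order R G' -> A `<=` G' -> carrier G' `<=` X -> G' `<=` A.
  move=> oG' AG' G'X p G'p; apply: contrapT => nAp.
  by apply: (Amax G') => //; split => // /(_ _ G'p).
exists A => //; apply: contrapT => nAX.
have [a ca] : carrier A !=set0.
  have [e [ea e0 eX]] := Xarc x0 Xx0.
  apply: contrapT => A0; apply: (A0); exists x0.
  have lA := ao_linear oA.
  apply: (ext _ (arc_order_arc ea)).
  - by move=> [x y] /(lin_carrier lA)[cx _]; case: A0; exists x.
  - by move=> x [s [t [_ [-> _]]]]; apply: eX; exists s.
  - by exists 0, 0; rewrite e0.
have [p [Xp Ap nAp]] : exists p, [/\ X p, closure (carrier A) p & ~ carrier A p].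
  apply: contrapT => np; apply: nAX; apply: coX.
  - by exists a.
  - by exists (carrier A); [exact: arc_order_open oA|apply/esym/setIidPr].
  - exists (closure (carrier A)); first exact: closed_closure.
    apply/seteqP; split => x.
      by move=> cx; split; [exact: AX|exact: subset_closure].
    by move=> [Xx cx]; apply: contrapT => nx; apply: np; exists x.
have [e [ea e0 eX]] := Xarc p Xp.
have [r cr] : exists r, carrier A (e r).
  have [] := Ap (range e); last by move=> x [cx [r _ rx]]; exists r; rewrite rx.
  by rewrite -e0; apply: arc_image_open => //; exact: filterT.
have oC := arc_order_open oA.
wlog rn : e ea e0 eX r cr / r < 0.
  move=> W; have [r0|r0|r0] := ltgtP r 0; first exact: (W e _ _ _ r).
    apply: (W (fun t => e (- t)) _ _ _ (- r)).
    - exact: (arc_comp ea (arc_opp R)).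
    - by rewrite oppr0.
    - by move=> x [t _ <-]; apply: eX; exists (- t).
    - by rewrite opprK.
    - lra.
  by apply: nAp; rewrite -e0 -r0.
have [|b [rb bA nb]] := exit_time (arc_continuous ea) oC rn cr; first by rewrite e0.
(* recentred at the exit time *)
pose e1 t := e (t + b); pose t0 := r - b.
have e1a : open_arc e1 by exact: (arc_comp ea (arc_translate b)).
have e1X : range e1 `<=` X by move=> x [t _ <-]; apply: eX; exists (t + b).
have t00 : t0 < 0 by rewrite /t0; lra.
have c1 t : t0 <= t < 0 -> carrier A (e1 t).
  by move=> tt; apply: bA; rewrite /t0 in tt; lra.
have n1 : ~ carrier A (e1 0) by rewrite /e1 add0r.
have t1 : t0 < t0 / 2 < 0 by lra.
have t1' : t0 <= t0 / 2 < 0 by lra.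
have [H|H] := lin_total (ao_linear oA) (c1 t0 ltac:(lra)) (c1 _ t1').
  have fin := final_arcP hT oA e1a c1 n1 t1 H.
  have [//|[G' [oG' AG' G'0 G'X]]] := prolong_or_compact oA AX coX e1a e1X t00 fin n1.
  exact/n1/(ext G').
have oA' := arc_order_dual oA.
have fin := final_arcP hT oA' e1a c1 n1 t1 H.
have [//|[G' [oG' AG' G'0 G'X]]] := prolong_or_compact oA' AX coX e1a e1X t00 fin n1.
apply/n1/(ext (dual G')) => //; first exact: arc_order_dual.
by move=> [x y] xy; apply: AG'.
Qed.

End Maximal.

(** * Connected one-manifolds that are not Lindelof *)

Lemma long_ray_origin_le (R : realType) (z : closed_long_ray R) :
  (long_ray_origin R <= z)%O.
Proof.
rewrite closed_long_ray_leE /= omega1_0P /=; apply/implyP => _.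
by have /andP[] := valP z.2.
Qed.

Section Classification.
Variables (R : realType) (T : topologicalType).
Implicit Types (G : set (T * T)).

Lemma countable_cofinal G : linear_on G -> ~ uncountable_cofinality G ->
  exists C, [/\ C `<=` carrier G, countable C
    & forall y, carrier G y -> exists2 c, C c & G (y, c)].
Proof.
move=> lG nu; apply: contrapT => nC; apply: nu => C CG cC.
apply: contrapT => ny; apply: nC; exists C; split => // y cy.
apply: contrapT => nc; apply: ny; exists y => // c Cc yc.
by apply: nc; exists c.
Qed.

Lemma arc_order_no_least G y : arc_order R G -> carrier G y ->
  exists z, G (z, y) /\ ~ G (y, z).
Proof.
move=> oG /(ao_arc oG)[e [ea <- ei _]]; exists (e (-1)).
by split; [apply/ei; lra|move=> /ei; lra].
Qed.

Lemma order_iso_inverse (O : Type) (z0 : O) (B : set O) (Y : set T) (h : O -> T) :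
  (forall y, Y y -> exists2 z, B z & h z = y) ->
  exists k : T -> O, forall y, Y y -> B (k y) /\ h (k y) = y.
Proof.
move=> hY; suff /choice[k kP] : forall y, exists z, Y y -> B z /\ h z = y.
  by exists k.
move=> y; have [/hY[z Bz zy]|nY] := pselect (Y y); first by exists z.
by exists z0.
Qed.

Lemma order_iso_inj d (O : orderTopologicalType d) G (B : set O) (h : O -> T)
    z w : (forall z w, B z -> B w -> G (h z, h w) <-> (z <= w)%O) ->
  B z -> B w -> h z = h w -> z = w.
Proof.
move=> hi Bz Bw E; apply/eqP; rewrite eq_le.
by apply/andP; split; apply/hi => //; [rewrite -E|rewrite E]; apply/hi.
Qed.

Lemma order_iso_homeomorphic d (O : orderTopologicalType d) (z0 : O) G
    (B : set O) (h : O -> T) : arc_order R G ->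
  (forall z w v, B z -> B w -> (z <= v)%O -> (v <= w)%O -> B v) ->
  (forall z w, B z -> B w -> G (h z, h w) <-> (z <= w)%O) ->
  (forall y, carrier G y -> exists2 z, B z & h z = y) ->
  homeomorphic (carrier G) B.
Proof.
move=> oG cB hi hs; have lG := ao_linear oG.
have chB z : B z -> carrier G (h z) by move=> Bz; apply/hi.
have [k kP] := order_iso_inverse z0 hs.
have kh z : B z -> k (h z) = z.
  by move=> Bz; have [Bk hk] := kP _ (chB _ Bz); exact: (order_iso_inj hi).
have hB : h @` B = carrier G.
  by apply/seteqP; split=> [_ [z Bz <-]|y /hs[z Bz <-]]; [exact: chB|exists z].
exists k; split.
  apply/seteqP; split => [_ [y /kP[Bk _] <-]//|z Bz].
  by exists (h z); [exact: chB|exact: kh].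
exists h; split.
- by move=> y /set_mem /kP[].
- by rewrite -hB; exact: order_iso_inverse_continuous oG cB hi kh.
- apply: (order_iso_continuous oG hi) => z w y Bz Bw zy yw.
  by apply: hs; have [] := lin_carrier lG yw.
Qed.

(** Adjoining a least element gives a closed long ray, by countability of the
    coinitiality; the adjoined element corresponds to the origin. *)
Lemma homeomorphic_long_ray G x0 : arc_order R G -> carrier G x0 ->
  uncountable_cofinality G -> ~ uncountable_cofinality (dual G) ->
  homeomorphic (carrier G) (@long_ray R).
Proof.
move=> oG cx0 uG nuG; have [lG rG aG] := oG.
have [C [CG cC Ccoi]] := countable_cofinal (lin_dual lG) nuG.
have [] := @closed_long_ray_iso R _ (adjoin_bottom G) None
  (lin_adjoin_bottom lG)
  (@real_intervals_adjoin_bottom R T G C lG rG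
     (fun y => @arc_order_no_least G y oG) CG cC Ccoi).
- by move=> [].
- by [].
- move=> D DG cD; pose D' := [set x | D (Some x)].
  have [||y cy yP] := uG D'.
  + by move=> x /DG.
  + apply: sub_countable (_ : countable [set odflt x0 d | d in D]); last first.
      exact: sub_countable (card_image_le _ _) cD.
    by apply: subset_card_le => x Dx; exists (Some x).
  + by exists (Some y) => // -[x Dx|_ []]; exact: (yP x).
move=> h [ch hi hs h0].
have some z : @long_ray R z -> h z = Some (odflt x0 (h z)).
  case E : (h z) => //= nz; case: nz; apply/eqP; rewrite eq_le long_ray_origin_le andbT.
  by apply/hi; rewrite E h0.
apply: (@order_iso_homeomorphic _ (closed_long_ray R) (long_ray_origin R) G
  (@long_ray R) (odflt x0 \o h)) => //.
- move=> z w v nz _ zv _ v0; apply: nz; apply/eqP.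
  by rewrite eq_le long_ray_origin_le andbT -v0.
- by move=> z w /some sz /some sw; rewrite -hi sz sw.
- move=> y cy; have [z zy] := hs (Some y) cy; exists z; last by rewrite /= zy.
  by move=> z0; move: zy; rewrite z0 h0.
Qed.

(** Truncating the order at [x0] gives it the least element that
    [closed_long_ray_iso] starts from. *)
Lemma half_order_iso G x0 : arc_order R G -> carrier G x0 ->
  uncountable_cofinality G -> exists h : closed_long_ray R -> T,
  [/\ forall z w, G (h z, h w) <-> (z <= w)%O, forall z, G (x0, h z),
      forall y, G (x0, y) -> exists z, h z = y & h (long_ray_origin R) = x0].
Proof.
move=> oG cx0 uG; have [lG rG aG] := oG.
pose G1 : set (T * T) := [set p | G p /\ G (x0, p.1)].
have [] := @closed_long_ray_iso R _ G1 x0.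
- split.
  + move=> x y [xy x0x]; have [cx cy] := lin_carrier lG xy.
    by split; split => //=; exact: (lin_trans lG x0x xy).
  + by move=> y x z [xy x0x] [yz _]; split => //; exact: (lin_trans lG xy yz).
  + by move=> x y [xy _] [yx _]; exact: (lin_anti lG xy yx).
  + by move=> x y [cx x0x] [cy x0y]; have [] := lin_total lG cx cy; [left|right].
- move=> a b [ab x0a] nab; have [g gP] := rG a b ab nab; exists g.
  have [g0 g1 gi gs] := gP; split => //.
    move=> s t s01 t01; split; first by move=> [/gi H _]; exact: H.
    move=> st; split; first exact/gi.
    by have [] := param_bounds gP s01 => + _; exact: (lin_trans lG x0a).
  by move=> x [ax _] [xb _]; exact: gs.
- by move=> y [cy x0y]; split.
- by split.
- move=> C CG cC; have [||y cy yP] := uG (C `|` [set x0]).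
  + by move=> c [/CG[]//|->].
  + rewrite -bigcup2inE; apply: bigcup_countable => // -[|[|i]] _ //=.
  + exists y; last by move=> c Cc [yc _]; apply: (yP c) => //; left.
    by split => //; apply: (lin_nle lG cy cx0); apply: yP; right.
move=> h [ch hi hs h0]; exists h; split => //.
- move=> z w; split; first by move=> zw; apply/hi; split => //; case: (ch z).
  by move=> /hi[].
- by move=> z; case: (ch z).
- move=> y x0y; apply: hs; split => //=.
  by have [] := lin_carrier lG x0y.
Qed.

Lemma order_iso_continuousT d (O : orderTopologicalType d) G x0 (h : O -> T) :
  arc_order R G -> (forall z w, G (h z, h w) <-> (z <= w)%O) ->
  (forall z, G (x0, h z)) -> (forall y, G (x0, y) -> exists z, h z = y) ->
  continuous h.
Proof.
move=> oG hi hx hs.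
have : {within setT, continuous h}.
  apply: (order_iso_continuous oG) => // z w y _ _ zy _.
  have [|v vy] := hs y; first exact: (lin_trans (ao_linear oG) (hx z) zy).
  by exists v.
exact: (continuous_subspace_setT h).2.
Qed.

(** The halves of the order above and below [x0] are closed long rays, glued at
    [x0] as in the wedge. *)
Lemma homeomorphic_long_line G x0 : arc_order R G -> closed (carrier G) ->
  carrier G x0 -> uncountable_cofinality G -> uncountable_cofinality (dual G) ->
  homeomorphic (carrier G) [set: long_line R].
Proof.
move=> oG cG cx0 uG uG'; have lG := ao_linear oG.
have oG' := arc_order_dual oG; have lG' := ao_linear oG'.
have [h1 [h1i h1x h1s h10]] := half_order_iso oG cx0 uG.
have [h2 [h2i h2x h2s h20]] := half_order_iso oG' cx0 uG'.
set o := long_ray_origin R in h10 h20.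
have [k1 k1P] : exists k : T -> closed_long_ray R,
    forall y, G (x0, y) -> setT (k y) /\ h1 (k y) = y.
  by apply: (order_iso_inverse o) => y /h1s[z zy]; exists z.
have [k2 k2P] : exists k : T -> closed_long_ray R,
    forall y, G (y, x0) -> setT (k y) /\ h2 (k y) = y.
  by apply: (order_iso_inverse o) => y /h2s[z zy]; exists z.
have k1h z : k1 (h1 z) = z.
  have [_ E] := k1P _ (h1x z).
  by apply: (@order_iso_inj _ _ G setT h1) E => // *; exact: h1i.
have k2h z : k2 (h2 z) = z.
  have [_ E] := k2P _ (h2x z).
  by apply: (@order_iso_inj _ _ (dual G) setT h2) E => // *; exact: h2i.
have k1c : {within [set y | G (x0, y)], continuous k1}.
  have -> : [set y | G (x0, y)] = h1 @` setT.
    by apply/seteqP; split=> [y /h1s[z <-]|_ [z _ <-]]; [exists z|exact: h1x].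
  by apply: (order_iso_inverse_continuous oG).
have k2c : {within [set y | G (y, x0)], continuous k2}.
  have -> : [set y | G (y, x0)] = h2 @` setT.
    by apply/seteqP; split=> [y /h2s[z <-]|_ [z _ <-]]; [exists z|exact: h2x].
  by apply: (order_iso_inverse_continuous oG').
pose wl b : closed_long_ray R -> long_line R :=
  @wedge_lift bool (fun=> closed_long_ray R) (fun=> o) b.
have wl_c b : continuous (wl b) by exact: wedge_lift_continuous.
have wl_o : wl true o = wl false o by exact: (@wedge_liftE _ _ _ _ o _ o).
pose H (b : bool) := if b then h1 else h2.
have HE b z : wedge_fun H (wl b z) = H b z.
  by rewrite /wl wedge_lift_funE// => -[] []; rewrite /H ?h10 ?h20.
pose f y := if `[< G (x0, y) >] then wl true (k1 y) else wl false (k2 y).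
have f1 y : G (x0, y) -> f y = wl true (k1 y).
  by move=> x0y; rewrite /f ifT//; exact/asboolP.
(* at x0 both formulas give the base point *)
have f2 y : G (y, x0) -> f y = wl false (k2 y).
  move=> yx0; rewrite /f; case: ifPn => // /asboolP x0y.
  have -> : y = x0 by exact: (lin_anti lG yx0 x0y).
  by rewrite -{1}h10 -h20 k1h k2h.
have glue (P : set T) k b : {within P, continuous k} ->
    (forall y, P y -> f y = wl b (k y)) -> {within P, continuous f}.
  move=> /subspace_continuousP kc fE; apply/subspace_continuousP => y Py.
  suff : f @ within P (nbhs y) --> f y by [].
  rewrite fE// => V /wl_c/(kc y Py); rewrite /within /nbhs /=.
  by apply: filterS => z kz Pz; rewrite /preimage /= fE//; exact: kz.
exists f; split.
  apply/seteqP; split => // w _.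
  have : (\bigcup_b (wl b @` setT)) w by rewrite wedgeTE.
  move=> [[] _ [z _ <-]].
    by exists (h1 z); [have [] := lin_carrier lG (h1x z)|rewrite (f1 _ (h1x z)) k1h].
  by exists (h2 z); [have [] := lin_carrier lG (h2x z)|rewrite (f2 _ (h2x z)) k2h].
exists (wedge_fun H); split.
- move=> y /set_mem cy; have [x0y|yx0] := lin_total lG cx0 cy.
    by rewrite f1// HE; have [] := k1P _ x0y.
  by rewrite f2// HE; have [] := k2P _ yx0.
- have -> : carrier G = [set y | G (x0, y)] `|` [set y | G (y, x0)].
    apply/seteqP; split => y; first exact: lin_total.
    by move=> [/(lin_carrier lG)[]|/(lin_carrier lG)[]].
  have cl P : open [set y | carrier G y /\ ~ P y] -> P `<=` carrier G -> closed P.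
    move=> oP PG; suff -> : P = carrier G `&` ~` [set y | carrier G y /\ ~ P y].
      by apply: closedI => //; exact: open_closedC.
    apply/seteqP; split=> [y Py|y [cy nPy]]; first by split; [exact: PG|case].
    by apply: contrapT => nP; exact: nPy.
  have up_open := arc_order_upper_open oG cx0.
  have lo_open := arc_order_lower_open oG cx0.
  apply: withinU_continuous.
  + apply: cl; last by move=> y /(lin_carrier lG)[].
    suff -> : [set y | carrier G y /\ ~ G (x0, y)] =
              [set y | G (y, x0) /\ ~ G (x0, y)] by [].
    apply/seteqP; split=> y [H1 H2]; split => //; first exact: lin_nle H2.
    by have [] := lin_carrier lG H1.
  + apply: cl; last by move=> y /(lin_carrier lG)[].
    suff -> : [set y | carrier G y /\ ~ G (y, x0)] =
              [set y | G (x0, y) /\ ~ G (y, x0)] by [].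
    apply/seteqP; split=> y [H1 H2]; split => //; first exact: lin_nle H2.
    by have [] := lin_carrier lG H1.
  + exact: glue k1c f1.
  + exact: glue k2c f2.
- apply: continuous_subspaceT; apply: wedge_fun_continuous.
    move=> [] /=; first exact: order_iso_continuousT oG h1i h1x h1s.
    exact: order_iso_continuousT oG' h2i h2x h2s.
  by move=> [] []; rewrite /H ?h10 ?h20.
Qed.

(** The carrier is the union of the countably many segments between a coinitial
    and a cofinal countable set. *)
Lemma arc_order_lindelof G : arc_order R G -> ~ uncountable_cofinality G ->
  ~ uncountable_cofinality (dual G) -> lindelof (carrier G).
Proof.
move=> oG nu nu'; have lG := ao_linear oG.
have [C [CG cC Ccof]] := countable_cofinal lG nu.
have [D [DG cD Dcof]] := countable_cofinal (lin_dual lG) nu'.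
have -> : carrier G = \bigcup_(c in C) \bigcup_(d in D) segment G d c.
  apply/seteqP; split => y; last first.
    by move=> [c _ [d _ [/(lin_carrier lG)[]]]].
  move=> cy; have [c Cc yc] := Ccof y cy; have [d Dd dy] := Dcof y cy.
  by exists c => //; exists d.
apply: lindelof_bigcup => // c Cc; apply: lindelof_bigcup => // d Dd.
have [dc|ndc] := pselect (G (d, c)).
  by apply: compact_lindelof; have [] := segment_connected_compact oG dc.
move=> E _ _; exists set0; split => // y [dy yc]; case: ndc.
exact: (lin_trans lG dy yc).
Qed.

(** The cofinalities of a maximal arc order in its two directions decide: both
    uncountable give the long line and only one gives the long ray, while two
    countable ones are excluded by [arc_order_lindelof]. *)
Theorem not_lindelof_long (X : set T) : hausdorff_space T ->
  closed X -> connected X -> X !=set0 ->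
  (forall x, X x -> exists e : R -> T, [/\ open_arc e, e 0 = x & range e `<=` X]) ->
  ~ lindelof X ->
  homeomorphic X (@long_ray R) \/ homeomorphic X [set: long_line R].
Proof.
move=> hT cX coX X0 aX nL; have [x0 Xx0] := X0.
have [|G oG GX] := maximal_arc_order hT coX X0 aX.
  by move=> /compact_lindelof.
have cx0 : carrier G x0 by rewrite GX.
have cX' : carrier (dual G) = X by rewrite -GX.
have [uG|nuG] := pselect (uncountable_cofinality G); last first.
  have [uG'|nuG'] := pselect (uncountable_cofinality (dual G)); last first.
    by case: nL; rewrite -GX; exact: arc_order_lindelof.
  left; rewrite -cX'; apply: (@homeomorphic_long_ray (dual G) x0) => //.
  - exact: arc_order_dual.
have [uG'|nuG'] := pselect (uncountable_cofinality (dual G)).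
  by right; rewrite -GX; apply: homeomorphic_long_line cx0 uG uG' => //; rewrite GX.
by left; rewrite -GX; exact: homeomorphic_long_ray cx0 uG nuG'.
Qed.

End Classification.

(** * Long rays leave Lindelof sets *)

(** The limit is the point of real coordinate 0 above the least strict upper bound
    of the ordinals [a k]. It depends only on them, so that interleaved
    sequences have the same limit. *)
Lemma omega1_seq_limit (R : realType) (a : nat -> omega1) :
  (forall k, (a k < a k.+1)%O) -> exists2 p, @long_ray R p &
    forall v : nat -> closed_long_ray R,
      (forall k, (a k < (v k).1 <= a k.+1)%O) -> v @ \oo --> p.
Proof.
move=> aS.
have a_mono j k : (j <= k)%N -> (a j <= a k)%O.
  move=> /subnK <-; elim: (k - j)%N => //= i; rewrite addSn => /le_trans.
  by apply; exact: ltW.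
have [|l lub lmin] := @omega1_well_ordered [set b | forall k, (a k < b)%O].
  by have [b] := omega1_seq_bounded a; exists b.
exists (l, Ico01_0 R).
  move=> /(congr1 fst)/= E; have := lub 0%N; rewrite E.
  by rewrite ltNge omega1_0P.
move=> v vP.
have lo w : (w < (l, Ico01_0 R) :> closed_long_ray R)%O ->
    \forall k \near \oo, (w < v k)%O.
  move=> wl; have w1 : (w.1 < l)%O.
    rewrite ltNge; apply/negP => lw; move: wl; rewrite ltNge => /negP; apply.
    rewrite closed_long_ray_leE /= lw /=; apply/implyP => _.
    by have /andP[] := valP w.2.
  have [k ka] : exists k, (w.1 <= a k)%O.
    apply: contrapT => nk; move: w1; rewrite ltNge => /negP; apply.
    apply: lmin => k /=; rewrite ltNge; apply/negP => wk.
    by apply: nk; exists k.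
  exists k => // j /= kj; rewrite ltNge; apply/negP.
  rewrite closed_long_ray_leE => /andP[vw _].
  have /andP[av _] := vP j.
  have := le_lt_trans (le_trans ka (a_mono _ _ kj)) av.
  by rewrite ltNge vw.
have up w : ((l, Ico01_0 R) < w :> closed_long_ray R)%O -> forall k, (v k < w)%O.
  move=> lw k; apply: lt_trans lw; rewrite ltNge; apply/negP.
  rewrite closed_long_ray_leE => /andP[/= lv _].
  have /andP[_ va] := vP k.
  by have := lub k.+1; rewrite ltNge (le_trans lv va).
move=> V; rewrite itv_nbhsE => -[i [io pi] iV].
suff : \forall k \near \oo, v k \in i by apply: filterS => k /iV.
case: i io pi {iV} => [[[] x|[]] [[] y|[]]] //= _; rewrite in_itv /=.
- move=> /andP[/lo H1 /up H2]; apply: filterS H1 => k vk.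
  by rewrite in_itv /= vk H2.
- by rewrite andbT => /lo; apply: filterS => k vk; rewrite in_itv /= vk.
- by move=> /up H; apply: nearW => k; rewrite in_itv /=.
- by move=> _; apply: nearW => k; rewrite in_itv.
Qed.

Definition countable_base_at (T : topologicalType) (x : T) (B : nat -> set T) :=
  [/\ forall k, nbhs x (B k), forall j k, (j <= k)%N -> B k `<=` B j
    & forall V, nbhs x V -> exists k, B k `<=` V].

Section LongRayLindelof.
Variables (R : realType) (T : topologicalType) (f : closed_long_ray R -> T).
Hypothesis hT : hausdorff_space T.
Hypothesis first_countable : forall x : T, exists B, countable_base_at x B.
Hypothesis fc : {within @long_ray R, continuous f}.
Hypothesis finj : forall z w, @long_ray R z -> @long_ray R w -> f z = f w -> z = w.

Let recurrent (V : set T) :=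
  forall a : omega1, exists2 z : closed_long_ray R, (a < z.1)%O & V (f z).

Let long_ray_gt (a : omega1) (z : closed_long_ray R) : (a < z.1)%O -> @long_ray R z.
Proof.
by move=> az z0; move: az; rewrite z0 ltNge omega1_0P.
Qed.

(** Times at which [f] is near [x] and times at which [f] is near [y] can be
    interleaved; at the common limit of these times, [f] takes both values. *)
Let recurrent_point_unique (x y : T) :
  (forall V, nbhs x V -> recurrent V) -> (forall V, nbhs y V -> recurrent V) ->
  x = y.
Proof.
move=> rx ry.
have [B [Bn Bd Bb]] := first_countable x; have [C [Cn Cd Cb]] := first_countable y.
have /choice[s sP] (p : omega1 * nat) : exists zw : closed_long_ray R * closed_long_ray R,
    [/\ (p.1 < zw.1.1)%O, (zw.1.1 < zw.2.1)%O, B p.2 (f zw.1) & C p.2 (f zw.2)].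
  have [z pz Bz] := rx _ (Bn p.2) p.1; have [w zw Cw] := ry _ (Cn p.2) z.1.
  by exists (z, w).
pose a := fix a k := if k is j.+1 then (s (a j, j)).2.1 else omega1_0.
have aS k : (a k < (s (a k, k)).1.1 < a k.+1)%O.
  by have [h1 h2 _ _] := sP (a k, k); rewrite h1 h2.
have [|p lp pP] := @omega1_seq_limit R a.
  by move=> k; have /andP[/lt_trans h /h] := aS k.
have fp (v : nat -> closed_long_ray R) u (D : nat -> set T) :
    (forall k, (a k < (v k).1 <= a k.+1)%O) ->
    (forall j k, (j <= k)%N -> D k `<=` D j) ->
    (forall V, nbhs u V -> exists k, D k `<=` V) -> (forall k, D k (f (v k))) ->
    f p = u.
  move=> /pP vp Dd Db Dv; apply: hT => A A' Ap A'u.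
  have vl : \forall k \near \oo, @long_ray R (v k).
    apply: vp; apply: open_nbhs_nbhs; split => //.
    apply: closed_openC; apply: accessible_closed_set1.
    exact/hausdorff_accessible/order_hausdorff.
  have : \forall k \near \oo, A (f (v k)).
    move/subspace_continuousP: fc => /(_ p lp A Ap) fA.
    have : \forall k \near \oo, @long_ray R (v k) -> A (f (v k)).
      exact: (vp [set z | @long_ray R z -> A (f z)] fA).
    by move: vl; apply: filterS2 => k lk /(_ lk).
  have [j DA'] := Db _ A'u => -[k _ kA].
  exists (f (v (maxn j k))); split; first by apply: kA; rewrite /= leq_maxr.
  by apply: DA'; apply: (Dd j (maxn j k)); rewrite ?leq_maxl.
transitivity (f p).
  apply/esym; apply: (fp (fun k => (s (a k, k)).1) x B) => // k.
    by have /andP[-> /ltW ->] := aS k.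
  by have [_ _ h _] := sP (a k, k).
apply: (fp (fun k => (s (a k, k)).2) y C) => // k.
  by have /andP[/lt_trans h /h ->] := aS k; rewrite /= lexx.
by have [_ _ _ h] := sP (a k, k).
Qed.

(** Were [f] to stay in [C], it would eventually remain, by a countable subcover
    argument, in each neighbourhood of its only recurrent point (without such a
    point, it would remain in the empty set). By first countability it would be
    eventually equal to this point, against injectivity. *)
Lemma long_ray_not_in_lindelof (C : set T) : lindelof C ->
  ~ (forall z, @long_ray R z -> C (f z)).
Proof.
move=> lC fC.
pose big (x : T) := forall V, nbhs x V -> recurrent V.
(* f eventually stays in every set which is a neighbourhood of all the
   recurrent points of C *)
have eventually W : (forall y, C y -> nbhs y W \/ ~ big y) ->
    exists a : omega1, forall z : closed_long_ray R, (a < z.1)%O -> W (f z).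
  move=> CW.
  have [||D [DC cD CD]] := lC [set O | open O /\ (O `<=` W \/ ~ recurrent O)].
  - by move=> O [].
  - move=> y Cy; have [Wy|nb] := CW y Cy.
      exists W^°; last exact: Wy.
      by split; [exact: open_interior|left; exact: interior_subset].
    have [V Vy nV] : exists2 V, nbhs y V & ~ recurrent V.
      apply: contrapT => nV; apply: nb => V Vy; apply: contrapT => H.
      by apply: nV; exists V.
    exists V^°; last exact: Vy.
    split; [exact: open_interior|right => rV; apply: nV => a].
    by have [z az Vz] := rV a; exists z => //; exact: interior_subset.
  have /choice[b bP] O : exists a : omega1, ~ recurrent O ->
      forall z : closed_long_ray R, (a < z.1)%O -> ~ O (f z).
    have [rO|nO] := pselect (recurrent O); first by exists omega1_0.
    apply: contrapT => na; apply: nO => a; apply: contrapT => nz; apply: na.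
    by exists a => _ z az Oz; apply: nz; exists z.
  have [|a aP] := @omega1_countable_bounded (b @` D).
    exact: sub_countable (card_image_le _ _) cD.
  exists a => z az; have [O DO Oz] := CD _ (fC z (long_ray_gt az)).
  have [_ [OW|nO]] := DC _ DO; first exact: OW.
  case: (bP O nO z) => //; apply: lt_trans az; apply: aP.
  by exists O.
have [[x bx]|nx] := pselect (exists x, big x); last first.
  have [|a aP] := eventually set0; first by move=> y Cy; right => by_; apply: nx; exists y.
  have [b ab] := omega1_seq_bounded (fun=> a).
  exact: (aP (b, Ico01_0 R) (ab 0%N)).
have [B [Bn Bd Bb]] := first_countable x.
have /choice[a aP] k : exists a : omega1,
    forall z : closed_long_ray R, (a < z.1)%O -> B k (f z).
  apply: eventually => y _; have [by_|nby] := pselect (big y); last by right.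
  by left; rewrite -(recurrent_point_unique bx by_).
have [b ab] := omega1_seq_bounded a.
have fx z : (b < z.1)%O -> f z = x.
  move=> bz; apply: hT => A A' Az A'x; have [k BA'] := Bb _ A'x.
  exists (f z); split; first exact: nbhs_singleton.
  by apply: BA'; apply: (aP k); exact: lt_trans bz.
have [c /(_ 0%N) bc] := omega1_seq_bounded (fun=> b).
have [d /(_ 0%N) cd] := omega1_seq_bounded (fun=> c).
have bd := lt_trans bc cd.
have E : (c, Ico01_0 R) = (d, Ico01_0 R) :> closed_long_ray R.
  apply: finj; [exact: (@long_ray_gt b)|exact: (@long_ray_gt b)|].
  by rewrite !fx.
by have /= := congr1 fst E => E'; move: cd; rewrite E' ltxx.
Qed.

End LongRayLindelof.

(** * Leaves of a foliation *)

Section Leaves.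
Variables (R : realType) (n : nat) (M : topologicalType) (F : foliation R n M).
Local Notation LS := (leaf_space F).
Local Notation model := (R * 'rV[R]_n.-1)%type.

Lemma plaque_open P O : plaque F P -> open (O : set M) -> open (P `&` O : set LS).
Proof.
move=> pP oO; exists [set P `&` O].
  move=> _ ->; apply: (@finI_from1 _ _ _ id); exists P, O.
  by split.
by rewrite bigcup_set1.
Qed.

(** The intersections of a plaque and an open set form a subbase of the leaf
    topology. *)
Lemma leaf_nbhs_cvg (p : LS) (E : set_system LS) : Filter E ->
  (forall P O, plaque F P -> open (O : set M) -> P p -> O p -> E (P `&` O)) ->
  forall V : set LS, nbhs p V -> E V.
Proof.
move=> FE EP V; rewrite nbhsE => -[O [[D DS <-] [A DA Ap]] OV].
have [A' A'S A'E] := DS A DA.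
have : E A.
  rewrite -A'E; apply: filter_bigI => B BA'.
  have /set_mem[P [O' [pP oO' BE]]] := A'S B BA'.
  have : B p by rewrite -A'E in Ap; exact: Ap.
  by rewrite BE => -[Pp O'p]; exact: EP.
by apply: filterS => x Ax; apply: OV; exists A.
Qed.

Lemma leaf_nbhs_finer (p : M) (V : set M) : nbhs p V -> nbhs (p : LS) V.
Proof.
move=> Vp; have [O [oO Op] OV] : exists2 O, open_nbhs p O & O `<=` V.
  by move: Vp; rewrite nbhsE.
have [c ac cp] := atlas_cover F p.
pose P := chart_dom c `&` [set q | (chart_map c q).2 = (chart_map c p).2].
have pP : plaque F P by exists c => //; exists (chart_map c p).2.
apply: (@filterS LS (nbhs (p : LS)) _ (P `&` O)); first by move=> q [_ /OV].
by apply: (@open_nbhs_nbhs LS); split; [exact: plaque_open|split].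
Qed.

Lemma leaf_space_hausdorff : hausdorff_space M -> hausdorff_space LS.
Proof.
move=> hM p q pq; apply: hM => A B Ap Bq.
by apply: pq; exact: leaf_nbhs_finer.
Qed.

(** An inverse [psi] of the chart [c], with the box split into the interval [I] of
    the times along the plaques and the set [D] of the transverse coordinates. *)
Record chart_inverse (c : chart R n M) (I : interval R) (D : set 'rV[R]_n.-1)
    (psi : model -> M) : Prop := ChartInverse {
  ci_itv : itv_open_ends I;
  ci_dom : forall p, chart_dom c p -> [/\ (chart_map c p).1 \in I,
    D (chart_map c p).2 & psi (chart_map c p) = p];
  ci_psi : forall t y, t \in I -> D y ->
    chart_dom c (psi (t, y)) /\ chart_map c (psi (t, y)) = (t, y);
  ci_open : open (chart_dom c);
  ci_map_cont : forall p, chart_dom c p -> {for p, continuous (chart_map c)};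
  ci_psi_cont : forall z V, z.1 \in I -> D z.2 -> nbhs (psi z) V ->
    \forall z' \near z, z'.1 \in I -> D z'.2 -> V (psi z') }.

Lemma chart_inverse_exists c : atlas F c -> exists I D psi, chart_inverse c I D psi.
Proof.
move=> /(atlas_foliated (f := F))[oc [B [I [J [oI _ BE]]] [cB [g [gK mc gc]]]]].
pose D : set 'rV[R]_n.-1 := [set y | forall i, y ord0 i \in J i].
exists I, D, g.
have dB p : chart_dom c p -> B (chart_map c p) by move=> cp; rewrite -cB; exists p.
split => //.
- move=> p cp; have := dB p cp; rewrite BE => -[pI pJ]; split => //.
  by apply: gK; exact: mem_set.
- move=> t y tI yD; have : B (t, y) by rewrite BE.
  by rewrite -{1}cB => -[p cp pE]; rewrite -pE gK ?inE.
- move=> p cp; move/subspace_continuousP: mc => /(_ p cp).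
  by rewrite within_interior//; exact: open_nbhs_nbhs.
- move=> z V z1 z2 Vz; have Bz : B z by rewrite BE.
  move/subspace_continuousP: gc => /(_ z Bz V Vz).
  rewrite /within /nbhs /=; apply: filterS => z' + h1 h2; apply.
  by rewrite BE.
Qed.

Section Chart.
Variables (c : chart R n M) (I : interval R) (D : set 'rV[R]_n.-1).
Variable psi : model -> M.
Hypotheses (ac : atlas F c) (ci : chart_inverse c I D psi).

Lemma plaque_path_continuous_manifold (s : R) y : s \in I -> D y ->
  forall V : set M, nbhs (psi (s, y)) V -> \forall s' \near s, s' \in I /\ V (psi (s', y)).
Proof.
move=> sI Dy V Vs.
have sI' : \forall s' \near s, s' \in I.
  apply: open_nbhs_nbhs; split => //.
  exact: (itv_open_ends_open (ci_itv ci)).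
have pc : (fun s' : R => (s', y)) @ s --> (s, y).
  apply: (@cvg_pair _ _ _ (nbhs s) (nbhs s) (nbhs y) _ _ _ id (fun=> y)).
    exact: cvg_id.
  exact: cvg_cst.
have := pc _ (ci_psi_cont ci (z := (s, y)) sI Dy Vs).
by apply: filterS2 sI' => s' s'I; rewrite /preimage /= => H; split => //; exact: (H s'I Dy).
Qed.

(** A coordinate change preserves horizontal lines locally, so the path stays
    for a while in every other plaque through one of its points. *)
Lemma plaque_path_continuous (s : R) y : s \in I -> D y ->
  (fun s' => psi (s', y) : LS) @ s --> (psi (s, y) : LS).
Proof.
move=> sI Dy.
have FE : Filter (fmap (fun s' => psi (s', y) : LS) (nbhs s)).
  exact: fmap_filter.
apply: (leaf_nbhs_cvg FE) => P O [c' ac' [y' PE]] oO Pq Oq.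
rewrite PE in Pq *; case: Pq => c'q y'q.
have [cq mq] := ci_psi ci sI Dy.
have [f [g fg]] := (atlas_compatible ac ac').1 _ cq c'q.
rewrite /nbhs /=.
have := nbhs_singleton fg; rewrite /= mq => /(congr1 snd)/= E.
have oc' : open (chart_dom c') by case: (atlas_foliated ac').
have : nbhs (psi (s, y)) (chart_dom c' `&` O `&`
    [set q | chart_map c' q = (f (chart_map c q), g (chart_map c q).2)]).
  apply: filterI => //; apply: filterI; exact: open_nbhs_nbhs.
move=> /(plaque_path_continuous_manifold sI Dy); apply: filterS.
move=> s' [s'I [[h1 h2] h3]]; split => //; split => //=.
by rewrite /= h3 /= (ci_psi ci s'I Dy).2 -E.
Qed.

Lemma plaque_path_connected (s t : R) y : s \in I -> t \in I -> D y ->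
  connected_component [set: LS] (psi (s, y)) (psi (t, y)).
Proof.
move=> sI tI Dy.
have : connected ((fun s' => psi (s', y) : LS) @` [set` I]).
  apply: connected_continuous_connected.
    exact/connected_intervalP/interval_is_interval.
  apply/subspace_continuousP => u uI.
  suff : (fun s' => psi (s', y) : LS) @ within [set` I] (nbhs u) --> (psi (u, y) : LS) by [].
  apply: cvg_trans (plaque_path_continuous uI Dy).
  by apply: cvg_app; exact: cvg_within.
move=> coP; apply: (connected_component_max _ _ coP) => //; first by exists s.
by exists t.
Qed.

End Chart.

(** Leaves are one-manifolds: a plaque, parametrised around a point, is an open arc
    for the leaf topology. *)
Lemma leaf_arc (p : LS) : exists e : R -> LS,
  [/\ open_arc e, e 0 = p & range e `<=` connected_component setT p].
Proof.
have [c ac cp] := atlas_cover F p.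
have [I [D [psi ci]]] := chart_inverse_exists ac.
have [sI Dy psiK] := ci_dom ci cp.
set s := (chart_map c p).1 in sI; set y := (chart_map c p).2 in Dy.
have psiE : psi (s, y) = p by rewrite -[RHS]psiK -surjective_pairing.
have /nbhs_ballP[r /= r0 rI] : nbhs s [set` I].
  by apply: open_nbhs_nbhs; split => //; exact: (itv_open_ends_open (ci_itv ci)).
have [|f [fa f0 fm fr]] := @squash_itv R (s - r) (s + r) s; first by lra.
have fI t : f t \in I.
  apply: rI; have : range f (f t) by exists t.
  rewrite fr /= in_itv /= => /andP[h1 h2].
  by rewrite /ball /= ltr_norml; apply/andP; split; lra.
exists (fun t => psi (f t, y)); split; last first.
- move=> _ [t _ <-]; rewrite -psiE.
  exact: (plaque_path_connected ac ci).
- by rewrite f0.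
split.
- move=> t u E; apply: (arc_inj fa).
  have [_ E1] := ci_psi ci (fI t) Dy; have [_ E2] := ci_psi ci (fI u) Dy.
  by have := congr1 (chart_map c) E; rewrite E1 E2 => -[].
- move=> t; apply: (@cvg_comp _ _ _ f (fun s' => psi (s', y) : LS) _ (nbhs (f t))).
    exact: (arc_continuous fa).
  exact: (plaque_path_continuous ac ci (fI t) Dy).
- move=> O oO; pose P := chart_dom c `&` [set q | (chart_map c q).2 = y].
  pose W := [set q | chart_dom c q /\ (f @` O) (chart_map c q).1].
  suff -> : [set psi (f t, y) | t in O] = P `&` W.
    apply: plaque_open; first by exists c => //; exists y.
    rewrite openE => q [cq fq]; apply: filterI.
      by apply: open_nbhs_nbhs; split => //; exact: (ci_open ci).
    have : {for q, continuous (fst \o chart_map c)}.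
      by apply: continuous_comp; [exact: (ci_map_cont ci)|exact: cvg_fst].
    by apply; apply: open_nbhs_nbhs; split => //; exact: (arc_open fa).
  apply/seteqP; split => [_ [t Ot <-]|q [[cq yq] [_ [t Ot tE]]]].
    have [h1 h2] := ci_psi ci (fI t) Dy.
    by rewrite /P /W /=; rewrite h2 /=; do !split => //; exists t.
  exists t => //; rewrite tE -yq -surjective_pairing.
  by have [] := ci_dom ci cq.
Qed.

Lemma leaf_long_of_not_lindelof (L : set LS) : hausdorff_space M ->
  leaf F L -> ~ lindelof L -> long F L.
Proof.
move=> hM [x ->] nL; apply: not_lindelof_long nL.
- exact: leaf_space_hausdorff.
- by apply: component_closed; exact: closedT.
- exact: component_connected.
- by exists x; exact: connected_component_refl.
- move=> p xp; have [e [ea e0 ep]] := leaf_arc p; exists e; split => //.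
  by apply: (subset_trans ep) => q; exact: connected_component_trans.
Qed.

Definition saturation (O : set M) : set M :=
  [set y | exists2 z, O z & connected_component [set: LS] y z].

Lemma saturation_component O (p q : LS) :
  connected_component setT p q -> saturation O q -> saturation O p.
Proof. by move=> pq [z Oz qz]; exists z => //; exact: connected_component_trans qz. Qed.

(** The points of the leaf of [p] near which all leaves meet [O] form an open and
    closed subset of this leaf, which is not empty. *)
Lemma saturation_nbhs O (p : M) : open O -> saturation O p ->
  nbhs p (saturation O).
Proof.
move=> oO [z Oz pz]; pose S := saturation O.
pose W := [set w : LS | nbhs (w : M) S].
have Wz : W z.
  have : nbhs (z : M) O by exact: open_nbhs_nbhs.
  by apply: filterS => q Oq; exists q => //; exact: connected_component_refl.
(* W is a union of plaques, because a neighbourhood of a point of a plaque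
   can be slid along the plaque *)
have slide c I D psi (s t : R) y : atlas F c -> chart_inverse c I D psi ->
    s \in I -> t \in I -> D y -> W (psi (s, y)) -> W (psi (t, y)).
  move=> ac ci sI tI Dy Ws.
  have [ct mt] := ci_psi ci tI Dy.
  have rc : (fun q => (s, (chart_map c q).2)) @ psi (t, y) --> (s, y).
    apply: (@cvg_pair _ _ _ (nbhs (psi (t, y))) (nbhs s) (nbhs y) _ _ _
      (fun=> s) (fun q => (chart_map c q).2)); first exact: cvg_cst.
    have E : (snd \o chart_map c) (psi (t, y)) = y by rewrite /= mt.
    rewrite -[X in _ --> nbhs X]E.
    by apply: continuous_comp; [exact: (ci_map_cont ci)|exact: cvg_snd].
  have := rc _ (ci_psi_cont ci (z := (s, y)) sI Dy Ws).
  have : nbhs (psi (t, y)) (chart_dom c).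
    by apply: open_nbhs_nbhs; split => //; exact: (ci_open ci).
  apply: filterS2 => q cq; rewrite /preimage /= => H.
  have [qI qD qE] := ci_dom ci cq.
  apply: saturation_component (H sI qD).
  rewrite -[X in connected_component _ X]qE [X in psi X]surjective_pairing.
  exact: (plaque_path_connected ac ci).
have plaque_nbhs (w : LS) : exists P : set LS,
    nbhs w P /\ forall q q', P q -> P q' -> W q -> W q'.
  have [c ac cw] := atlas_cover F w.
  have [I [D [psi ci]]] := chart_inverse_exists ac.
  exists (chart_dom c `&` [set q | (chart_map c q).2 = (chart_map c w).2]); split.
    rewrite -[X in nbhs _ X]setIT; apply: open_nbhs_nbhs; split => //.
    by apply: plaque_open; [exists c => //; exists (chart_map c w).2|exact: openT].
  move=> q q' [cq yq] [cq' yq'].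
  have [qI qD qE] := ci_dom ci cq; have [q'I q'D q'E] := ci_dom ci cq'.
  have E : q = psi ((chart_map c q).1, (chart_map c w).2).
    by rewrite -yq -surjective_pairing qE.
  have E' : q' = psi ((chart_map c q').1, (chart_map c w).2).
    by rewrite -yq' -surjective_pairing q'E.
  rewrite E E'.
  by apply: (slide c I D psi _ _ _ ac ci) => //; rewrite -yq.
have oW : open W.
  rewrite openE => w Ww; have [P [wP PW]] := plaque_nbhs w.
  by apply: filterS (wP) => q Pq; apply: PW Ww => //; exact: nbhs_singleton.
have cW : closed W.
  rewrite -[W]setCK; apply: open_closedC; rewrite openE => w nWw.
  have [P [wP PW]] := plaque_nbhs w.
  apply: filterS (wP) => q Pq Wq; apply: nWw; apply: PW Wq => //.
  exact: nbhs_singleton.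
suff /seteqP[_ /(_ p)[]] : connected_component [set: LS] p `&` W =
    connected_component [set: LS] p by [|exact: connected_component_refl|].
apply: component_connected.
- by exists z.
- by exists W.
- by exists W.
Qed.

(** A long leaf contains an injective image of the long ray, namely one half of it
    if it is a long line. *)
Lemma long_not_in_lindelof (L : set LS) (C : set M) : hausdorff_space M ->
  (forall x : M, exists B, countable_base_at x B) -> long F L ->
  lindelof C -> ~ (L `<=` C).
Proof.
move=> hM fcM longL lC LC.
suff [f [fc finj fL]] : exists f : closed_long_ray R -> LS,
    [/\ {within @long_ray R, continuous f},
        forall z w, @long_ray R z -> @long_ray R w -> f z = f w -> z = w
      & forall z, @long_ray R z -> L (f z)].
  apply: (@long_ray_not_in_lindelof R M f hM fcM _ finj C lC).
    move/subspace_continuousP: fc => fc; apply/subspace_continuousP => z lz V Vz.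
    exact: (fc z lz V (leaf_nbhs_finer Vz)).
  by move=> z /fL /LC.
case: longL => -[f [fL [g [fK fc gc]]]].
  exists g; split => //.
  - move=> z w; rewrite -fL => -[p Lp <-] [q Lq <-].
    by rewrite !fK ?inE// => ->.
  - by move=> z; rewrite -fL => -[p Lp <-]; rewrite fK ?inE.
pose wl : closed_long_ray R -> long_line R :=
  @wedge_lift bool (fun=> closed_long_ray R) (fun=> long_ray_origin R) true.
have gi u v : g u = g v -> u = v.
  have : (f @` L) u by rewrite fL.
  have : (f @` L) v by rewrite fL.
  by move=> [q Lq <-] [p Lp <-]; rewrite !fK ?inE// => ->.
have gcT : continuous g by exact: (continuous_subspace_setT g).2.
exists (g \o wl); split.
- apply: continuous_subspaceT => z; apply: continuous_comp; last exact: gcT.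
  exact: wedge_lift_continuous.
- move=> z w _ _ /gi E.
  have := congr1 (@wedge_fun bool (fun=> closed_long_ray R)
    (fun=> long_ray_origin R) (closed_long_ray R) (fun _ x => x)) E.
  by rewrite /wl !wedge_lift_funE.
- move=> z _ /=; have : (f @` L) (wl z) by rewrite fL.
  by move=> [p Lp <-]; rewrite fK ?inE.
Qed.

End Leaves.

(** The base is the preimage under a chart of the balls of radius 1 / (k + 1). *)
Lemma manifold_first_countable (R : realType) n (M : topologicalType) (x : M) :
  manifold R n M -> exists B, countable_base_at x B.
Proof.
move=> [_ _ /(_ x)[U [oU Ux] [V oV [f [fUV [g [gK fc gc]]]]]]].
have fUx : V (f x) by rewrite -fUV; exists x.
exists (fun k => U `&` f @^-1` ball (f x) k.+1%:R^-1); split.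
- move=> k; apply: filterI; first exact: open_nbhs_nbhs.
  move/subspace_continuousP: fc => /(_ x Ux).
  rewrite within_interior; last exact: open_nbhs_nbhs.
  by apply; apply: nbhsx_ballx; rewrite invr_gt0.
- move=> j k jk y [Uy yk]; split => //; apply: le_ball yk.
  by rewrite lef_pV2 ?posrE// ler_nat.
- move=> W Wx; have Wg : nbhs (g (f x)) W by rewrite gK ?inE.
  have /nbhs_ballP[r /= r0 rW] : nbhs (f x) [set v | V v -> W (g v)].
    by move/subspace_continuousP: gc => /(_ (f x) fUx W Wg).
  have [k kr] : exists k : nat, k.+1%:R^-1 < r.
    have r1 : 0 <= r^-1 by rewrite invr_ge0 ltW.
    exists (Num.truncn r^-1); rewrite invf_plt ?posrE//.
    by have /andP[] := truncn_itv r1.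
  exists k => y [Uy /(le_ball (ltW kr)) /rW H].
  by rewrite -(gK y) ?inE//; apply: H; rewrite -fUV; exists y.
Qed.

Theorem proposition1p4 (R : realType) (n : nat) (M : topologicalType)
    (F : foliation R n M) (L : set M) :
  (2 <= n)%N -> manifold R n M -> type_I M ->
  leaf F L -> long F L ->
  exists N : set M, [/\ L `<=` interior N
    & forall L' : set M, leaf F L' -> L' `&` N !=set0 -> long F L'].
Proof.
move=> _ mM [U [oU lU UU UT]] leafL longL.
have hM : hausdorff_space M by case: mM.
have fcM (x : M) := manifold_first_countable x mM.
pose S a := saturation F (~` closure (U a)).
have Smono a b : (a <= b)%O -> S b `<=` S a.
  rewrite le_eqVlt => /predU1P[->//|ab] y [z nz yz]; exists z => // az; apply: nz.
  exact/subset_closure/(UU a b ab).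
have LS a : L `<=` S a.
  move=> x Lx; have [z [Lz nz]] : exists z, L z /\ ~ closure (U a) z.
    apply: contrapT => nz; apply: (long_not_in_lindelof hM fcM longL (lU a)).
    by move=> z Lz; apply: contrapT => naz; apply: nz; exists z.
  exists z => //; case: leafL Lx Lz => x0 -> x0x x0z.
  by apply: connected_component_trans x0z; exact: connected_component_sym.
have nbhsS a x : S a x -> nbhs x (S a).
  by apply: saturation_nbhs; apply: closed_openC; exact: closed_closure.
exists (\bigcap_a S a); split.
  move=> x Lx; have [B [Bn _ Bb]] := fcM x.
  have /choice[k kP] a : exists k, B k `<=` S a by apply/Bb/nbhsS/LS.
  have [j jP] := omega1_cofinal_fibre k.
  apply: (filterS _ (Bn j)) => y Bjy a _.
  by have [b ab kb] := jP a; apply: (Smono a b ab); apply: kP; rewrite kb.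
move=> L' leafL' [y [L'y Ny]]; apply: leaf_long_of_not_lindelof => // lL'.
have [||D [DU cD L'D]] := lL' [set O | exists a, O = U a].
- move=> _ [a ->]; rewrite openE => z Uz; apply: leaf_nbhs_finer.
  exact: open_nbhs_nbhs.
- move=> z _; have [a _ Uz] : (\bigcup_a U a) z by rewrite UT.
  by exists (U a) => //; exists a.
have /choice[idx idxP] O : exists a, D O -> O = U a.
  by have [/DU[a ->]|nD] := pselect (D O); [exists a|exists omega1_0].
have [|b bP] := @omega1_countable_bounded (idx @` D).
  exact: sub_countable (card_image_le _ _) cD.
have [z nz yz] := Ny b I; apply: nz.
have [O DO Oz] : (\bigcup_(O in D) O) z.
  apply: L'D; case: leafL' L'y => x0 -> x0y.
  exact: connected_component_trans x0y yz.
apply/subset_closure/(UU (idx O) b); first by apply: bP; exists O.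
by apply: subset_closure; rewrite -idxP.
Qed.
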